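(* Let $\Sigma$ be the normal fan of a smooth $d$-dimensional lattice polytope $P \subset \mathbb{R}^d$, let $X_\Sigma$ be the associated toric variety, and let $\pi : \mathbb{C}^{\Sigma(1)} \setminus Z(\Sigma) \to X_\Sigma$ be the Cox quotient morphism. There exist an affine variety $U \subset \mathbb{C}^{\Sigma(1)} \setminus Z(\Sigma)$ and an affine open subset $\mathcal{U} \subset X_\Sigma$ such that: 1. $\pi_{|U} : U \to \mathcal{U}$ is an isomorphism; 2. inverting $\pi_{|U}$ yields a positive rational parametrization $\varphi : \mathbb{C}^d \dashrightarrow U$ (namely, $\varphi$ is the rational map given by $(\pi_{|U})^{-1}$ on $\mathcal{U} \cap (\mathbb{C}^* )^d$, where $(\mathbb{C}^* )^d \subset X_\Sigma$ is the dense torus), and the normal fan of its Newton polytope is $\Sigma_{\mathrm{Newt}(\varphi)} = \Sigma$; 3. $\pi(U_{\geq 0}) = (X_\Sigma)_{\geq 0}$, where $U_{\geq 0} = U \cap \mathbb{R}^{\Sigma(1)}_{\geq 0}$.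
   Context: Normal fans: for a full-dimensional polytope $P \subset \mathbb{R}^d$, $\Sigma_P$ denotes its inner normal fan, whose cones are, for each face $Q$ of $P$, the set of $w \in \mathbb{R}^d$ such that $\langle w, \cdot\rangle$ is minimized over $P$ at every point of $Q$. The polytope $P$ is smooth if $\Sigma_P$ is smooth, i.e. the primitive ray generators of every $d$-dimensional cone form a $\mathbb{Z}$-basis of $\mathbb{Z}^d$. Cox construction: $\Sigma(1) = \{\rho_1,\dots,\rho_n\}$ is the set of rays of $\Sigma$ (also used for their primitive generators in $\mathbb{Z}^d$), so $\mathbb{C}^{\Sigma(1)} = \mathbb{C}^n$ with coordinates $u_1,\dots,u_n$. $Z(\Sigma) \subset \mathbb{C}^n$ is the zero set of the irrelevant ideal $B(\Sigma) = \langle \prod_{i : \rho_i \not\subset \sigma} u_i : \sigma \in \Sigma\rangle$. The toric variety is the quotient $X_\Sigma = (\mathbb{C}^n \setminus Z(\Sigma))/G$ with $G = \mathrm{Hom}_{\mathbb{Z}}(\mathrm{Cl}(X_\Sigma), \mathbb{C}^* )$ and quotient morphism $\pi$; here $G$ is identified with the kernel of the monomial map $(\mathbb{C}^* )^n \to (\mathbb{C}^* )^d$, $u \mapsto (u^{F_{1,:}},\dots,u^{F_{d,:}})$, where $F = (\rho_1 \cdots \rho_n) \in \mathbb{Z}^{d\times n}$ has rows $F_{i,:}$, and $\pi$ restricts on $(\mathbb{C}^* )^n$ to this monomial map onto the dense torus $(\mathbb{C}^* )^d \subset X_\Sigma$. Nonnegative part: $(X_\Sigma)_{\geq 0} = \{p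 \in X_\Sigma : \pi^{-1}(p) \cap \mathbb{R}^n_{\geq 0} \neq \emptyset\}$. Rational parametrizations: write a rational map from $\mathbb{C}^d$ as $\varphi = (r_1/s_1,\dots,r_n/s_n)$, where for each $i$ the polynomials $r_i, s_i$ in $t_1,\dots,t_d$ are coprime. It is positive if all these numerators $r_i$ and denominators $s_i$ have nonnegative coefficients. Its Newton polytope is the Minkowski sum of the Newton polytopes of all these polynomials, $\mathrm{Newt}(\varphi) = \sum_{i=1}^n (\mathrm{Newt}(r_i) + \mathrm{Newt}(s_i))$, where $\mathrm{Newt}$ of a polynomial is the convex hull of the exponents of its monomials. *)

(* Defs.v *)
From mathcomp Require Export all_boot all_order all_algebra.
From mathcomp Require Export complex.
From mathcomp Require Export boolp classical_sets reals.
From mathcomp Require Export mpoly.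

Set Implicit Arguments.
Unset Strict Implicit.
Unset Printing Implicit Defensive.

Import Order.TTheory GRing.Theory Num.Theory.
Local Open Scope ring_scope.
Local Open Scope classical_set_scope.

(* The complex numbers are R[i] for R : realType; in the order of R[i],
   0 <= z means that z is real and nonnegative. *)

Section Polytopes.
Variables (R : realType) (d : nat).
Implicit Types (P Q A B : set 'cV[R]_d) (w x y : 'cV[R]_d) (v : 'cV[int]_d).

Definition dotv w x : R := \sum_(i < d) w i 0 * x i 0.

Definition to_real v : 'cV[R]_d := map_mx intr v.

Definition convex_hull A : set 'cV[R]_d :=
  [set x | exists k (a : 'I_k -> R) (p : 'I_k -> 'cV[R]_d),
     [/\ forall j, 0 <= a j, \sum_j a j = 1, forall j, A (p j)
       & x = \sum_j a j *: p j]].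

Definition minkowski A B : set 'cV[R]_d := [set x + y | x in A & y in B].

(* For a cone A this is dim A = k: a basis of the linear span can be chosen in
   A. *)
Definition span_dim A (k : nat) :=
  exists X : k.-tuple 'cV[R]_d,
    [/\ free X, forall x, x \in X -> A x & forall x, A x -> x \in <<X>>%VS].

Definition lattice_polytope P :=
  exists V : seq 'cV[int]_d, P = convex_hull [set to_real v | v in [set` V]].

Definition full_dimensional P :=
  exists2 x0, P x0 & span_dim [set x - x0 | x in P] d.

(* Only nonempty faces are considered: for Q empty the cone attached to Q in
   the normal fan would be the whole space. *)
Definition face P Q :=
  Q !=set0 /\
  exists w, Q = [set x | P x /\ forall y, P y -> dotv w x <= dotv w y].

Definition normal_cone P Q : set 'cV[R]_d :=
  [set w | forall x, Q x -> forall y, P y -> dotv w x <= dotv w y].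

Definition normal_fan P : set (set 'cV[R]_d) :=
  [set s | exists2 Q, face P Q & s = normal_cone P Q].

Definition ray_of v : set 'cV[R]_d :=
  [set a *: to_real v | a in [set a : R | 0 <= a]].

(* In particular v <> 0, since 0 = 0 *+ 2. *)
Definition primitive v := forall (k : nat) v', v = v' *+ k -> k = 1%N.

(* The rays of a cone s of the fan S are the one-dimensional cones of S
   contained in s. *)
Definition ray_generators_in (S : set (set 'cV[R]_d)) (s : set 'cV[R]_d) :
    set 'cV[int]_d :=
  [set v | primitive v /\
           exists rho, [/\ S rho, span_dim rho 1, rho `<=` s & rho (to_real v)]].

Definition is_Zbasis (S : set 'cV[int]_d) :=
  exists k (b : 'M[int]_(d, k)),
    S = range (fun j => col j b) /\
    forall v, exists! c : 'cV[int]_k, v = b *m c.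

Definition smooth_fan (S : set (set 'cV[R]_d)) :=
  forall s, S s -> span_dim s d -> is_Zbasis (ray_generators_in S s).

(* The columns of F enumerate the primitive generators of the rays of S,
   without repetition. *)
Definition ray_matrix (S : set (set 'cV[R]_d)) n (F : 'M[int]_(d, n)) :=
  injective (fun j => col j F) /\
  range (fun j => col j F) = ray_generators_in S setT.

End Polytopes.
Arguments ray_of R {d} v _.

(* Complex varieties as spaces with functions.  The underlying set is a subset
   of an ambient type, so that maps between spaces are total functions on the
   ambient types and only their values on points matter.  Likewise
   is_regular V f, for V open, only concerns the values of f on V. *)
Record space (K : Type) := Space {
  ambient : Type;
  points : set ambient;
  is_open : set (set ambient);
  is_regular : set ambient -> set (ambient -> K) }.
Arguments points {K} s _.
Arguments is_open {K} s _.
Arguments is_regular {K} s _ _.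

Section Spaces.
Variable K : Type.
Implicit Types X Y : space K.

(* The structure induced on a locally closed subset S of X. *)
Definition subspace X (S : set (ambient X)) : space K :=
  {| ambient := ambient X;
     points := S;
     is_open := [set W | exists2 V, is_open X V & W = S `&` V];
     is_regular := fun W => [set f | forall x, W x ->
       exists V g, [/\ is_open X V, V x, is_regular X V g
                     & forall y, W y -> V y -> f y = g y]] |}.

(* The quotient of X by the fibres of p : X -> T, with the quotient topology;
   regular functions are those whose pullback to X is regular. *)
Definition quotient_space X (T : Type) (p : ambient X -> T) : space K :=
  let preim V := points X `&` p @^-1` V in
  {| ambient := T;
     points := p @` points X;
     is_open := [set V | V `<=` p @` points X /\ is_open X (preim V)];
     is_regular := fun V => [set f : T -> K | is_regular X (preim V) (f \o p)] |}.

Definition morphism X Y (f : ambient X -> ambient Y) :=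
  [/\ forall x, points X x -> points Y (f x),
      forall V, is_open Y V -> is_open X (points X `&` f @^-1` V)
    & forall V g, is_open Y V -> is_regular Y V g ->
        is_regular X (points X `&` f @^-1` V) (g \o f)].

Definition isomorphism X Y (f : ambient X -> ambient Y) :=
  @morphism X Y f /\
  exists g, [/\ @morphism Y X g,
                forall x, points X x -> g (f x) = x
              & forall y, points Y y -> f (g y) = y].

End Spaces.
Arguments subspace {K} X S.
Arguments quotient_space {K} X {T} p.
Arguments morphism {K} X Y f.
Arguments isomorphism {K} X Y f.

Section Affine.
Variables (R : realType) (n : nat).
Implicit Types (S : set {mpoly R[i][n]}) (u : 'I_n -> R[i]).

Definition zero_locus S : set ('I_n -> R[i]) :=
  [set u | forall p, S p -> p.@[u] = 0].

Definition ideal_span S : set {mpoly R[i][n]} :=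
  [set p | exists k (a g : 'I_k -> {mpoly R[i][n]}),
     (forall j, S (g j)) /\ p = \sum_j a j * g j].

Definition zariski_closed (A : set ('I_n -> R[i])) :=
  exists S, A = zero_locus S.

Definition affine_space : space R[i] :=
  {| ambient := 'I_n -> R[i];
     points := setT;
     is_open := [set V | zariski_closed (~` V)];
     is_regular := fun V => [set f | forall x, V x ->
       exists p q : {mpoly R[i][n]}, q.@[x] != 0 /\
         forall y, V y -> q.@[y] != 0 -> f y = p.@[y] / q.@[y]] |}.

Definition irreducible (A : set ('I_n -> R[i])) :=
  A !=set0 /\
  forall B C, zariski_closed B -> zariski_closed C ->
    A `<=` B `|` C -> A `<=` B \/ A `<=` C.

Definition affine_variety (A : set ('I_n -> R[i])) :=
  zariski_closed A /\ irreducible A.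

Definition torus : set ('I_n -> R[i]) := [set u | forall i, u i != 0].

Definition nonneg_orthant : set ('I_n -> R[i]) := [set u | forall i, 0 <= u i].

End Affine.

Definition is_affine (R : realType) (X : space R[i]) :=
  exists m (A : set ('I_m -> R[i])) (f : ambient X -> 'I_m -> R[i]),
    affine_variety A /\
    isomorphism X (subspace (affine_space R m) A) f.

Section Cox.
Variables (R : realType) (d n : nat).
Variables (S : set (set 'cV[R]_d)) (F : 'M[int]_(d, n)).
Implicit Types (u : 'I_n -> R[i]) (t : 'I_d -> R[i]).

Definition irrelevant_ideal : set {mpoly R[i][n]} :=
  ideal_span [set p | exists2 s, S s &
    p = \prod_(j < n | `[< ~ (ray_of R (col j F) `<=` s) >]) 'X_j].

Definition cox_Z : set ('I_n -> R[i]) := zero_locus irrelevant_ideal.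

Definition monomial_map u : 'I_d -> R[i] := fun i => \prod_j u j ^ F i j.

Definition cox_group : set ('I_n -> R[i]) :=
  [set g | torus g /\ monomial_map g = fun=> 1].

(* The points of the toric variety are the orbits of cox_group; on the
   complement of cox_Z all orbits are closed when the fan S is smooth. *)
Definition cox_pi u : set ('I_n -> R[i]) :=
  [set (fun j => g j * u j) | g in cox_group].

Definition toric_variety : space R[i] :=
  quotient_space (subspace (affine_space R n) (~` cox_Z)) cox_pi.

(* The point t of the dense torus of the toric variety: the fibre of
   monomial_map over t, which is a single orbit of cox_group. *)
Definition torus_point t : set ('I_n -> R[i]) :=
  [set u | torus u /\ monomial_map u = t].

Definition toric_nonneg : set (set ('I_n -> R[i])) :=
  [set p | points toric_variety p /\
     exists u, [/\ ~ cox_Z u, cox_pi u = p & nonneg_orthant u]].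

End Cox.

Section RationalMaps.
Variables (R : realType) (d n : nat).

Definition mcoprime (p q : {mpoly R[i][d]}) :=
  forall g p' q' : {mpoly R[i][d]},
    p = g * p' -> q = g * q' -> g \is a GRing.unit.

(* A rational map from C^d to C^n, with components in lowest terms. *)
Record rational_map := RationalMap {
  numer : 'I_n -> {mpoly R[i][d]};
  denom : 'I_n -> {mpoly R[i][d]};
  denom_neq0 : forall j, denom j != 0;
  numer_denom_coprime : forall j, mcoprime (numer j) (denom j) }.

Implicit Types phi : rational_map.

Definition defined_at phi (t : 'I_d -> R[i]) :=
  forall j, (denom phi j).@[t] != 0.

Definition rat_eval phi (t : 'I_d -> R[i]) : 'I_n -> R[i] :=
  fun j => (numer phi j).@[t] / (denom phi j).@[t].

Definition positive_map phi :=
  forall j m, 0 <= (numer phi j)@_m /\ 0 <= (denom phi j)@_m.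

Definition newton (p : {mpoly R[i][d]}) : set 'cV[R]_d :=
  convex_hull [set (\col_(i < d) (m i)%:R) | m in [set` msupp p]].

Definition newton_map phi : set 'cV[R]_d :=
  \big[@minkowski R d/[set 0]]_(j < n)
    minkowski (newton (numer phi j)) (newton (denom phi j)).

End RationalMaps.

(* Main.v *)
Require Import Defs.
From mathcomp Require Import ring lra zify.

(* Every class in Pic X is an integer vector b in Z^n modulo the row space of
   F, and ampleness is an open condition on b.  A unimodular completion of F by
   rows A_1, ..., A_r all representing ample classes therefore exists; it is
   obtained from any completion whose first row is a primitive multiple of the
   class of P by adding a large multiple of that row to the others.

   Let p_k be a homogeneous polynomial of degree A_k in the Cox ring, a sum with
   positive coefficients of the monomials of the vertices of the polytope of
   A_k.  The p_k vanish on Z and are positive at the other points of the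
   nonnegative orthant, and their characters form a basis of the character group
   of G.  Hence U = {p_1 = ... = p_r = 1} is a slice for the action of G on
   {p_1 ... p_r <> 0}, and pi identifies it with an affine open set containing
   the nonnegative part.  On the torus the inverse is
   u_j = t^{beta_j} prod_k f_k(t)^{- c_{jk}}, where f_k is the dehomogenization
   of p_k.  Adjusting one coefficient of each f_k makes them pairwise coprime,
   so these fractions are in lowest terms, and the Newton polytope is a sum of
   the polytopes of the A_k, all of which have normal fan Sigma. *)

Set Implicit Arguments.
Unset Strict Implicit.
Unset Printing Implicit Defensive.

Import Order.TTheory GRing.Theory Num.Theory.
Local Open Scope ring_scope.
Local Open Scope classical_set_scope.

(** * Simplicial fans and ample classes *)

Section Dotv.
Variables (R : realType) (d : nat).
Implicit Types (w x y : 'cV[R]_d).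

(** All geometry of the normal fan is compressed into integer data: index sets [I i], dual bases
    [G i] and one ample vector. Any set that contains the vertices of an ample vector and satisfies
    its facet inequalities has the same normal fan, so the Newton polytope never has to be computed.
    Numerators and denominators both contribute to it, so the class of row [k] of [A] enters with
    weight the sum over [j] of the absolute values of [c j k]; the signs in [c] are harmless. The
    obstacle is that the Newton polytope is defined through lowest terms. Coprimality in several
    variables is reduced to disjointness of roots in one variable by restriction to a curve. A
    factor of a polynomial with nonnegative coefficients may have negative ones and lose degree on
    the curve, but the product itself does not, and this is enough. *)

Lemma dotvC w x : dotv w x = dotv x w.
Proof. by apply: eq_bigr => i _; rewrite mulrC. Qed.

Lemma dotvDl w w' x : dotv (w + w') x = dotv w x + dotv w' x.
Proof. by rewrite -big_split; apply: eq_bigr => i _; rewrite mxE mulrDl. Qed.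

Lemma dotvZl c w x : dotv (c *: w) x = c * dotv w x.
Proof. by rewrite /dotv mulr_sumr; apply: eq_bigr => i _; rewrite mxE mulrA. Qed.

Lemma dotv0l x : dotv 0 x = 0.
Proof. by apply: big1 => i _; rewrite mxE mul0r. Qed.

Lemma dotvDr w x y : dotv w (x + y) = dotv w x + dotv w y.
Proof. by rewrite !(dotvC w) dotvDl. Qed.

Lemma dotvZr c w x : dotv w (c *: x) = c * dotv w x.
Proof. by rewrite !(dotvC w) dotvZl. Qed.

Lemma dotvNr w x : dotv w (- x) = - dotv w x.
Proof. by rewrite -scaleN1r dotvZr mulN1r. Qed.

Lemma dotvBr w x y : dotv w (x - y) = dotv w x - dotv w y.
Proof. by rewrite dotvDr dotvNr. Qed.

Lemma dotvBl w w' x : dotv (w - w') x = dotv w x - dotv w' x.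
Proof. by rewrite !(dotvC _ x) dotvBr. Qed.

Lemma dotv_suml (I : Type) (r : seq I) (Q : pred I) (f : I -> 'cV[R]_d) x :
  dotv (\sum_(i <- r | Q i) f i) x = \sum_(i <- r | Q i) dotv (f i) x.
Proof.
elim/big_rec2: _ => [|i y z _ <-]; first exact: dotv0l.
by rewrite dotvDl.
Qed.

Lemma dotv_sumr (I : Type) (r : seq I) (Q : pred I) (f : I -> 'cV[R]_d) x :
  dotv x (\sum_(i <- r | Q i) f i) = \sum_(i <- r | Q i) dotv x (f i).
Proof. by rewrite dotvC dotv_suml; apply: eq_bigr => i _; rewrite dotvC. Qed.

Lemma dotv_col n (F : 'M[int]_(d, n)) j (m : 'cV[int]_d) :
  dotv (to_real R (col j F)) (to_real R m) = ((F^T *m m) j 0)%:~R.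
Proof.
rewrite !mxE rmorph_sum; apply: eq_bigr => i _.
by rewrite !mxE rmorphM.
Qed.

Lemma mulmx_colE m n p (A : 'M[int]_(m, n)) (B : 'M[int]_(n, p)) i j :
  (A *m col j B) i 0 = (A *m B) i j.
Proof. by rewrite !mxE; apply: eq_bigr => k _; rewrite mxE. Qed.

End Dotv.

(** Smith normal form of a one-row matrix: the left factor is 1 by 1, and the sign of the resulting
    scalar is absorbed in [M]. *)
Lemma row_multiple_unimodular r (y : 'rV[int]_r.+1) : y != 0 ->
  exists g (M : 'M[int]_r.+1), [/\ M \in unitmx, 0 < g & y = g *: row 0 M].
Proof.
move=> y0; have [L _ [M uM [s _ E]]] := int_Smith_normal_form y.
have {}E : y = (L 0 0 * s`_0) *: row 0 M.
  rewrite E [L]mx11_scalar !mul_scalar_mx -scalemxAl -scalerA; congr (_ *: _).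
    by rewrite mxE eqxx mulr1n.
  apply/rowP => j; rewrite !mxE (bigD1 0) //= !mxE /= mulr1n big1 ?addr0 //.
  by move=> k /negPf k0; rewrite mxE eq_sym [_ == _ :> nat]k0 mulr0n mul0r.
have : L 0 0 * s`_0 != 0 by apply: contraNneq y0 => g0; rewrite E g0 scale0r.
case: (ltrgtP 0 (L 0 0 * s`_0)) => // [g0 _|g0 _]; first by exists (L 0 0 * s`_0), M.
exists (- (L 0 0 * s`_0)), (- M); split; rewrite ?oppr_gt0 //.
  by rewrite -scaleN1r unitmxZ // unitrN1.
by rewrite linearN /= scalerN scaleNr opprK.
Qed.

Section Fan.
Variables (R : realType) (d n N : nat) (F : 'M[int]_(d, n)).
Variables (I : 'I_N -> pred 'I_n) (G : 'I_N -> 'M[int]_(d, n)).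

(* For b in Z^n the point of the torus-fixed vertex i of the polytope
   {x | <F_j, x> + b_j >= 0 for all j} is - G i *m b, and slack i b is the
   vector of its facet distances. *)
Definition slack i (b : 'cV[int]_n) : 'cV[int]_n := b - F^T *m (G i *m b).

(** Strict convexity of the support function of [b]: the facets outside [I i] stay away from vertex
    [i]. *)
Definition ample (b : 'cV[int]_n) := forall i j, ~~ I i j -> 0 < slack i b j 0.

Definition conic (J : pred 'I_n) : set 'cV[R]_d :=
  [set w | exists lam : 'I_n -> R, [/\ forall j, 0 <= lam j,
     forall j, ~~ J j -> lam j = 0
   & w = \sum_j lam j *: to_real R (col j F)]].

Definition facet_polytope (b : 'cV[int]_n) : set 'cV[R]_d :=
  [set x | forall j, 0 <= dotv (to_real R (col j F)) x + (b j 0)%:~R].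

(** The maximal cones are the [conic (I i)]; the columns of [G i] indexed by [I i] are the basis
    dual to their generators, integral by smoothness. [fan_cover] is completeness and [fan_ample]
    projectivity. *)
Record simplicial_fan (a : 'cV[int]_n) : Prop := SimplicialFan {
  fan_inv : forall i, G i *m F^T = 1%:M;
  fan_dual : forall i j l, I i j -> (F^T *m G i) j l = (j == l)%:R;
  fan_off : forall i x l, ~~ I i l -> G i x l = 0;
  fan_cover : forall w, exists i, conic (I i) w;
  fan_ray : forall i j, conic (I i) (to_real R (col j F)) -> I i j;
  fan_ample : ample a }.

Variables (a : 'cV[int]_n) (H : simplicial_fan a).

Lemma slackD i b b' : slack i (b + b') = slack i b + slack i b'.
Proof. by rewrite /slack !mulmxDr opprD addrACA. Qed.

Lemma slackZ i k b : slack i (k *: b) = k *: slack i b.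
Proof. by rewrite /slack -!scalemxAr scalerBr. Qed.

Lemma slack0 i : slack i 0 = 0.
Proof. by rewrite /slack !mulmx0 subr0. Qed.

Lemma slack_sum i (K : Type) (r : seq K) (Q : pred K) (f : K -> 'cV[int]_n) :
  slack i (\sum_(k <- r | Q k) f k) = \sum_(k <- r | Q k) slack i (f k).
Proof.
elim/big_rec2: _ => [|k y z _ <-]; first exact: slack0.
by rewrite slackD.
Qed.

(** Adding [F^T *m x] translates the polytope without changing facet distances, so [slack] depends
    only on the divisor class. *)
Lemma slackF i x : slack i (F^T *m x) = 0.
Proof. by rewrite /slack !mulmxA -(mulmxA F^T) (fan_inv H) mulmx1 subrr. Qed.

Lemma slack_on i b j : I i j -> slack i b j 0 = 0.
Proof.
move=> Ij; rewrite /slack mulmxA 2!mxE [X in _ - X]mxE (bigD1 j) //= (fan_dual H) //.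
rewrite eqxx mul1r big1 ?addr0 ?subrr // => l /negPf ne.
by rewrite (fan_dual H) // eq_sym ne mul0r.
Qed.

Lemma slack_ge0 i b j : ample b -> 0 <= slack i b j 0.
Proof.
move=> Hb; case: (boolP (I i j)) => [/slack_on->//|/(Hb i j)]; exact: ltW.
Qed.

Lemma slack_eq0 i b j : ample b -> (slack i b j 0 == 0) = I i j.
Proof.
move=> Hb; apply/idP/idP => [/eqP E|/slack_on->//].
by apply/negPn/negP => /(Hb i j); rewrite E ltxx.
Qed.

Definition vertex i (b : 'cV[int]_n) : 'cV[int]_d := - (G i *m b).

Lemma slackE i b : slack i b = b + F^T *m vertex i b.
Proof. by rewrite /vertex mulmxN. Qed.

Lemma dotv_vertex i b j :
  dotv (to_real R (col j F)) (to_real R (vertex i b)) =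
  (slack i b j 0)%:~R - (b j 0)%:~R.
Proof. by rewrite dotv_col slackE [in RHS]mxE intrD addrC addKr. Qed.

Lemma conic_coord i lam j :
    (forall l, ~~ I i l -> lam l = 0) -> I i j ->
  dotv (\sum_l lam l *: to_real R (col l F)) (to_real R (col j (G i))) = lam j.
Proof.
move=> off Ij; rewrite dotv_suml (bigD1 j) //= big1 ?addr0.
  rewrite dotvZl dotv_col mulmx_colE (fan_dual H) // eqxx mulr1 //.
move=> l ne; case: (boolP (I i l)) => [Il|/off ->]; last by rewrite scale0r dotv0l.
by rewrite dotvZl dotv_col mulmx_colE (fan_dual H) // (negPf ne) mulr0.
Qed.

(** Crossing a facet of a maximal cone. A vector with coefficient -1 at [j] and large ones at the
    other rays of [I i] lies just beyond the facet opposite to [j]; a cone containing it is the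
    neighbour. *)
Lemma wall i j : I i j ->
  exists2 i', forall l, I i l -> l != j -> I i' l & ~~ I i' j.
Proof.
move=> Ij.
have Ha := fan_ample H.
(* [M] exceeds all slacks of [a]; slacks being integers, a single nonzero one weighted by [M]
   outweighs the negative term at [j]. *)
pose M : int := 1 + \sum_i' \sum_l slack i' a l 0.
have ltM i' l : slack i' a l 0 < M.
  rewrite /M ltr_pwDl // (bigD1 i') //= (bigD1 l) //= -addrA lerDl addr_ge0 //.
    by apply: sumr_ge0 => *; exact: slack_ge0.
  by apply: sumr_ge0 => *; apply: sumr_ge0 => *; exact: slack_ge0.
pose mu l : R := if l == j then -1 else if I i l then M%:~R else 0.
have muoff l : ~~ I i l -> mu l = 0.
  by rewrite /mu => Il; case: eqP Il => [->|_ /negPf->//]; rewrite Ij.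
have [i' [lam [lam0 lamoff Elam]]] := fan_cover H (\sum_l mu l *: to_real R (col l F)).
pose ev (nu : 'I_n -> R) x := dotv (\sum_l nu l *: to_real R (col l F)) x.
have evE nu i0 : ev nu (to_real R (vertex i0 a)) =
    \sum_l nu l * (slack i0 a l 0)%:~R - \sum_l nu l * (a l 0)%:~R.
  rewrite /ev dotv_suml -sumrB; apply: eq_bigr => l _.
  by rewrite dotvZl dotv_vertex mulrBr.
have E0 : ev mu = ev lam by apply: funext => x; rewrite /ev Elam.
have slack0' nu i0 : (forall l, ~~ I i0 l -> nu l = 0) ->
    \sum_l nu l * (slack i0 a l 0)%:~R = 0.
  move=> off; apply: big1 => l _; case: (boolP (I i0 l)) => Il.
    by rewrite slack_on // mulr0.
  by rewrite off // mul0r.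
(* On the polytope of [a] the functional is minimal at vertex [i'], so its value there is at most
   that at vertex [i]. *)
have le1 : \sum_l mu l * (slack i' a l 0)%:~R <= 0.
  have E1 := evE mu i'; have E2 := evE lam i'; have E3 := evE mu i.
  have E4 := evE lam i; rewrite slack0' // in E2; rewrite slack0' // in E3.
  rewrite E0 in E1 E3.
  have : 0 <= \sum_l lam l * (slack i a l 0)%:~R.
    by apply: sumr_ge0 => l _; rewrite mulr_ge0 // ler0z slack_ge0.
  lra.
have on l : I i l -> l != j -> I i' l.
  move=> Il ne; rewrite -(slack_eq0 i' l Ha) eq_le slack_ge0 // andbT -ltzD1 add0r.
  rewrite ltNge; apply/negP => ge1.
  have := le1; rewrite (bigD1 j) //= (bigD1 l) //= {1 2}/mu eqxx (negPf ne) Il.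
  apply/negP; rewrite -ltNge addrA ltr_pwDl //.
    rewrite mulN1r addrC subr_gt0 -intrM ltr_int.
    apply: lt_le_trans (ltM i' j) _; rewrite ler_peMr //.
    by apply/ltW/(le_lt_trans _ (ltM i j)); rewrite slack_ge0.
  apply: sumr_ge0 => l' /andP[ne' _]; rewrite mulr_ge0 //.
    rewrite /mu (negPf ne'); case: ifP => // _; rewrite ler0z.
    by apply/ltW/(le_lt_trans _ (ltM i j)); rewrite slack_ge0.
  by rewrite ler0z slack_ge0.
exists i' => //; apply/negP => I'j.
(* Otherwise [I i] is contained in [I i'], and uniqueness of coefficients in the cone [i'] gives -1
   = [lam j], which is nonnegative. *)
have sub l : I i l -> I i' l by case: (eqVneq l j) => [->//|ne /on]; exact.
have : mu j = lam j.
  rewrite -(@conic_coord i' mu j) // ?Elam ?conic_coord // => l I'l.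
  by apply: muoff; apply: contra I'l; exact: sub.
have := lam0 j; rewrite /mu eqxx => /[swap] <-; lra.
Qed.

(** The face exposed by [w] is where the facets in the support of [lam] are tight. Asking of [Q]
    only to lie between the vertices and the facet inequalities lets this apply to [P] and to Newton
    polytopes alike. *)
Lemma conic_normal_cone Q b i lam :
    ample b -> Q `<=` facet_polytope b ->
    (forall i, Q (to_real R (vertex i b))) ->
    (forall j, 0 <= lam j) -> (forall j, ~~ I i j -> lam j = 0) ->
  let w := \sum_j lam j *: to_real R (col j F) in
  let Qw := [set x | Q x /\ forall y, Q y -> dotv w x <= dotv w y] in
  Qw (to_real R (vertex i b)) /\ normal_cone Q Qw = conic (fun j => 0 < lam j).
Proof.
move=> Hb subQ Qv lam0 off w Qw.
have ev (nu : 'I_n -> R) x : dotv (\sum_j nu j *: to_real R (col j F)) x =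
    \sum_j nu j * (dotv (to_real R (col j F)) x + (b j 0)%:~R)
    - \sum_j nu j * (b j 0)%:~R.
  rewrite dotv_suml -sumrB; apply: eq_bigr => l _.
  by rewrite dotvZl mulrDr addrK.
have ge0 nu x : (forall j, 0 <= nu j) -> Q x ->
    0 <= \sum_j nu j * (dotv (to_real R (col j F)) x + (b j 0)%:~R).
  by move=> nu0 Qx; apply: sumr_ge0 => j _; rewrite mulr_ge0 //; exact: subQ.
have tight (nu : 'I_n -> R) i0 : (forall j, 0 < nu j -> I i0 j) -> (forall j, 0 <= nu j) ->
    \sum_j nu j * (dotv (to_real R (col j F)) (to_real R (vertex i0 b)) + (b j 0)%:~R) = 0.
  move=> on nu0; apply: big1 => j _; rewrite dotv_vertex subrK.
  have := nu0 j; rewrite le_eqVlt => /predU1P[<-|/on Ij]; first by rewrite mul0r.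
  by rewrite slack_on // mulr0.
have lamI j : 0 < lam j -> I i j.
  by move=> gt0; apply: contraLR gt0 => /off->; rewrite ltxx.
have Qw_of i0 : (forall j, 0 < lam j -> I i0 j) -> Qw (to_real R (vertex i0 b)).
  move=> on; split=> // y Qy.
  by rewrite !ev (tight lam i0) // sub0r lerBrDr addNr ge0.
have QwP x : Qw x -> Q x /\
    forall j, 0 < lam j -> dotv (to_real R (col j F)) x + (b j 0)%:~R = 0.
  move=> [Qx /(_ _ (Qv i))]; rewrite !ev tight // sub0r lerBlDr addNr => le0.
  split=> // j j0; have := ge0 lam x lam0 Qx.
  rewrite le_eqVlt ltNge le0 orbF eq_sym psumr_eq0 => [/allP/(_ j)|l _]; last first.
    by rewrite mulr_ge0 //; exact: subQ.
  by rewrite mem_index_enum mulf_eq0 gt_eqF //= => /(_ isT)/eqP.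
split; first exact: Qw_of.
apply/seteqP; split=> w' /=; last first.
  move=> [nu [nu0 nuoff ->]] x /QwP[Qx tx] y Qy.
  rewrite !ev lerD2r [leLHS]big1 ?ge0 // => j _.
  case: (boolP (0 < lam j)) => [/tx->|/nuoff->]; by rewrite ?mulr0 ?mul0r.
have [i' [nu [nu0 nuoff ->]]] := fan_cover H w'; move=> Nw'.
exists nu; split=> // j; rewrite -leNgt => lamj.
have {}lamj : lam j = 0 by apply/eqP; rewrite eq_le lamj lam0.
have nuI l : 0 < nu l -> I i' l.
  by move=> gt0; apply: contraLR gt0 => /nuoff->; rewrite ltxx.
apply/eqP/negPn/negP => nuj.
(* A maximal cone containing the support of [lam] has its vertex on the face, where [w'] is minimal;
   a positive [nu j] then makes facet [j] tight there. Crossing the wall opposite to [j] contradicts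
   this. *)
have key i0 : (forall j, 0 < lam j -> I i0 j) -> I i0 j.
  move=> /[dup] on /Qw_of/Nw'/(_ _ (Qv i')); rewrite !ev (tight nu i') // lerD2r.
  move=> le0; rewrite -(slack_eq0 i0 j Hb) -(eqr_int R).
  move: (ge0 nu _ nu0 (Qv i0)); rewrite le_eqVlt ltNge le0 orbF eq_sym.
  rewrite psumr_eq0 => [/allP/(_ j)|l _]; last first.
    by rewrite mulr_ge0 //; exact: subQ.
  by rewrite mem_index_enum mulf_eq0 (negPf nuj) dotv_vertex subrK => /(_ isT).
have [i'' sub] := wall (key _ lamI).
rewrite key // => l l0; apply: sub; first exact: lamI.
by apply: contraTneq l0 => ->; rewrite lamj ltxx.
Qed.

(* The fan only depends on the index sets I, not on the polytope: this is how
   the normal fans of P and of the Newton polytope are compared. *)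
Lemma normal_fanE Q b : ample b -> Q `<=` facet_polytope b ->
    (forall i, Q (to_real R (vertex i b))) ->
  normal_fan Q = [set s | exists i (J : pred 'I_n), (forall j, J j -> I i j) /\ s = conic J].
Proof.
move=> Hb subQ Qv; apply/seteqP; split=> s /=.
  move=> [_ [_ [w ->]] ->]; have [i [lam [lam0 off ->]]] := fan_cover H w.
  have [_ ->] := conic_normal_cone Hb subQ Qv lam0 off.
  exists i, (fun j => 0 < lam j); split=> // j.
  by apply: contraLR => /off->; rewrite ltxx.
move=> [i [J [JI ->]]].
pose lam j : R := (J j)%:R.
have lam0 j : 0 <= lam j by rewrite ler0n.
have off j : ~~ I i j -> lam j = 0.
  by move=> /(contra (JI j)) /negPf; rewrite /lam => ->.
have [Qw] := conic_normal_cone Hb subQ Qv lam0 off.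
set Qf := [set x | _] in Qw *; move=> E; exists Qf.
  by split; [exists (to_real R (vertex i b)) | eexists].
rewrite E; congr conic; apply: funext => j.
by rewrite /lam ltr0n lt0b.
Qed.

(** [A] stacked on [F] has the left inverse [(c B)]. The columns of [c] are one-parameter subgroups
    of the Cox group, dual to the characters in the rows of [A]. *)
Definition completes r (A : 'M[int]_(r, n)) (c : 'M[int]_(n, r)) (B : 'M[int]_(n, d)) :=
  [/\ c *m A + B *m F = 1%:M, A *m c = 1%:M & F *m c = 0].

Lemma completes_unit r A c B (M : 'M[int]_r) :
  M \in unitmx -> completes A c B -> completes (M *m A) (c *m invmx M) B.
Proof.
move=> uM [h1 h2 h3]; split; first by rewrite mulmxA -(mulmxA c) mulVmx // mulmx1.
  by rewrite mulmxA -(mulmxA M) h2 mulmx1 mulmxV.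
by rewrite mulmxA h3 mul0mx.
Qed.

(** The generators of one smooth maximal cone form a lattice basis, so the classes of the other rays
    freely generate the class group; [A] consists of the corresponding unit rows. *)
Lemma completes_vertex i : exists A c,
  @completes #|[pred j | ~~ I i j]| A c (G i)^T.
Proof.
pose A : 'M[int]_(#|[pred j | ~~ I i j]|, n) := \matrix_(k, j) (enum_val k == j)%:R.
have GF : F *m (G i)^T = 1%:M by apply: trmx_inj; rewrite trmx_mul trmxK trmx1 (fan_inv H).
have AG : A *m (G i)^T = 0.
  apply/matrixP => k x; rewrite !mxE (bigD1 (enum_val k)) //= big1 ?addr0.
    by rewrite !mxE (fan_off H) ?mulr0 //; have := enum_valP k.
  by move=> j /negPf ne; rewrite mxE eq_sym ne mul0r.
have AA : A *m A^T = 1%:M.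
  apply/matrixP => k l; rewrite !mxE (bigD1 (enum_val k)) //= big1 ?addr0.
    by rewrite !mxE eqxx mul1r (inj_eq enum_val_inj) eq_sym.
  by move=> j /negPf ne; rewrite mxE eq_sym ne mul0r.
exists A, ((1%:M - (G i)^T *m F) *m A^T); split.
- suff: (1%:M - (G i)^T *m F) *m (1%:M - A^T *m A) = 0.
    by rewrite mulmxBr mulmx1 mulmxA => /subr0_eq <-; rewrite subrK.
  apply/matrixP => x j; rewrite mxE [RHS]mxE; apply: big1 => l _.
  rewrite [X in _ * X]mxE [in X in _ * X]mxE [in X in _ * X]mxE.
  have -> : (A^T *m A) l j = (~~ I i l && (l == j))%:R.
    rewrite mxE; case: (boolP (I i l)) => Il /=.
      apply: big1 => k _; rewrite !mxE; case: eqP => [E|]; last by rewrite mul0r.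
      by have := enum_valP k; rewrite E inE Il.
    rewrite (bigD1 (enum_rank_in (Il : l \in [pred j | ~~ I i j]) l)) //= big1 ?addr0.
      by rewrite !mxE enum_rankK_in // eqxx mul1r.
    move=> k ne; rewrite !mxE; case: eqP => [E|]; last by rewrite mul0r.
    by case/negP: ne; apply/eqP/enum_val_inj; rewrite enum_rankK_in.
  case: (boolP (I i l)) => Il; last by rewrite /= subrr mulr0.
  suff -> : (1%:M - (G i)^T *m F) x l = 0 by rewrite mul0r.
  rewrite mxE [(- _ : 'M__) _ _]mxE.
  have -> : ((G i)^T *m F) x l = (F^T *m G i) l x.
    by rewrite !mxE; apply: eq_bigr => k _; rewrite !mxE mulrC.
  by rewrite (fan_dual H) // mxE eq_sym subrr.
- by rewrite mulmxA mulmxBr mulmx1 mulmxA AG mul0mx subr0 AA.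
- by rewrite mulmxA mulmxBr mulmx1 mulmxA GF mul1mx subrr mul0mx.
Qed.

(* A unimodular completion of F whose first new row is ample (a primitive
   multiple of the class of a) becomes one with all new rows ample after
   adding a large multiple of that row to the others. *)
Lemma ample_completion : exists r A c B,
  @completes r A c B /\ forall k, ample (row k A)^T.
Proof.
have [i0 _] := fan_cover H 0.
have [A [c]] := completes_vertex i0; set B := (G i0)^T.
have : (0 < #|[pred j | ~~ I i0 j]|)%N -> exists j, ~~ I i0 j.
  by case/card_gt0P => j; exists j.
move: #|_| A c => [|r] A c ex_j C; first by exists 0%N, A, c, B; split=> // -[].
have [//|j0 Ij0] := ex_j.
(* [y] is the class of [a] in the basis formed by the rows of [A]; it is nonzero because the slack
   of [a] at [j0] is. *)
pose y := a^T *m c.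
have slackA i : slack i a = slack i (y *m A)^T.
  have -> : a = (y *m A)^T + F^T *m (a^T *m B)^T.
    case: C => h1 _ _; apply: trmx_inj; rewrite linearD /= trmxK trmx_mul !trmxK.
    by rewrite -!mulmxA -mulmxDr h1 mulmx1.
  by rewrite slackD slackF addr0.
have y0 : y != 0.
  apply: contraTneq (fan_ample H Ij0); rewrite slackA => ->.
  by rewrite mul0mx trmx0 slack0 mxE.
have [g [M [uM g0 yE]]] := row_multiple_unimodular y0.
have {C} C := completes_unit uM C.
have row0 : ample (row 0 (M *m A))^T.
  move=> i j Ij; have := fan_ample H Ij; rewrite slackA yE -scalemxAl linearZ /=.
  by rewrite -row_mul slackZ mxE pmulr_rgt0.
move: (M *m A) (c *m _) C row0 => {y slackA y0 yE}A {}c C row0.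
(* [K] exceeds every slack of the rows, while those of row 0 off [I i] are at least 1. [E] adds [K]
   times row 0 to the other rows; it has square zero, so [1%:M + E] is unimodular. *)
pose K : int := 1 + \sum_i \sum_k \sum_j `|slack i (row k A)^T j 0|.
pose E : 'M[int]_r.+1 := \matrix_(k, l) (K *+ ((k != 0) && (l == 0))).
have EE : E *m E = 0.
  apply/matrixP => k l; rewrite !mxE big1 // => x _; rewrite !mxE.
  by case: (x == 0); rewrite ?andbF ?mulr0n ?mul0r // mulr0.
have uE : 1%:M + E \in unitmx.
  have /mulmx1_unit[] // : (1%:M + E) *m (1%:M - E) = 1%:M.
  by rewrite mulmxDl !mulmxBr !mulmx1 mul1mx EE subr0 subrK.
have {}C := completes_unit uE C; exists r.+1; do 3!eexists; split; first exact: C.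
move=> k i j Ij; rewrite mulmxDl mul1mx linearD /=.
have [->|k0] := eqVneq k 0.
  rewrite [row 0 (E *m A)](_ : _ = 0) ?addr0 ?row0 //.
  by apply/rowP => l; rewrite !mxE big1 // => x _; rewrite mxE eqxx mulr0n mul0r.
have -> : row k (E *m A) = K *: row 0 A.
  apply/rowP => l; rewrite !mxE (bigD1 0) //= big1 ?addr0; first by rewrite mxE k0 eqxx.
  by move=> x /negPf x0; rewrite mxE x0 andbF mulr0n mul0r.
rewrite linearD linearZ /= slackD slackZ mxE [X in _ + X]mxE.
have ltK : `|slack i (row k A)^T j 0| < K.
  rewrite /K ltr_pwDl // (bigD1 i) //= (bigD1 k) //= (bigD1 j) //= -!addrA lerDl.
  by rewrite !addr_ge0 //; do ?[apply: sumr_ge0 => *].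
have := row0 i j Ij; move: ltK; move: (slack _ _ _ _) (slack _ _ _ _) => x z; nia.
Qed.

End Fan.

Lemma ltn_count (T : eqType) (p q : pred T) (s : seq T) x :
    (forall y, y \in s -> p y -> q y) -> x \in s -> q x -> ~~ p x ->
  (count p s < count q s)%N.
Proof.
move=> pq xs qx px; have le_pq s' : {subset s' <= s} -> (count p s' <= count q s')%N.
  elim: s' => //= y s' IH sub; apply: leq_add.
    by have := pq y (sub _ (mem_head _ _)); case: (p y) => // ->.
  by apply: IH => z zs; apply: sub; rewrite inE zs orbT.
have E (r : pred T) : count r s = (r x + count r (rem x s))%N.
  by have /permP-> := perm_to_rem xs.
rewrite !E qx (negPf px) add0n add1n ltnS; apply: le_pq; exact: mem_rem.
Qed.

Lemma seq_argmin (R : realDomainType) (T : eqType) (f : T -> R) (s : seq T) x :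
  x \in s -> exists2 y, y \in s & forall z, z \in s -> f y <= f z.
Proof.
elim: s x => // y s IH x _; case: s IH => [|z s] IH.
  by exists y; rewrite ?mem_head // => z; rewrite inE => /eqP->.
have [u us Hu] := IH z (mem_head _ _).
have [le|/ltW le] := leP (f y) (f u).
  exists y; rewrite ?mem_head // => t; rewrite inE => /predU1P[->//|/Hu].
  exact: le_trans.
exists u; first by rewrite inE us orbT.
by move=> t; rewrite inE => /predU1P[->//|/Hu].
Qed.

Lemma primitive_divisor d (z : 'cV[int]_d) : z != 0 ->
  exists z' k, primitive z' /\ z = z' *+ k.
Proof.
pose sz (z : 'cV[int]_d) := (\sum_i absz (z i 0%R))%N.
move: {2}(sz z).+1 (ltnSn (sz z)) => m; elim: m z => // m IH z lt z0.
have [pz|] := pselect (primitive z); first by exists z, 1%N.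
move=> /existsNP[k /existsNP[z' /not_implyP[E /eqP k1]]].
have z'0 : z' != 0 by apply: contraNneq z0 => z'0; rewrite E z'0 mul0rn.
have [|z'' [l [pz'' E'']]] := IH z' _ z'0; last first.
  by exists z'', (l * k)%N; split=> //; rewrite E E'' mulrnA.
have k2 : (1 < k)%N.
  case: k k1 E => [|[|k]] // _ E; by rewrite E mulr0n eqxx in z0.
rewrite ltnS in lt; apply: leq_trans lt.
have szE : sz z = (sz z' * k)%N.
  rewrite /sz big_distrl /=; apply: eq_bigr => i _.
  by rewrite E mulmxnE -mulr_natr abszM /= natz.
rewrite szE ltn_Pmulr // lt0n; apply: contraNneq z'0 => /eqP.
rewrite sum_nat_eq0 => /forallP Z; apply/eqP/colP => i; rewrite mxE.
by apply/eqP; rewrite -absz_eq0; exact: Z.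
Qed.

(** * Lattice points on rational lines *)

Section Rational.
Variables (R : realType) (d m : nat).

(** Rank does not change from the rationals to [R]; a rational kernel vector is then multiplied by
    all its denominators. *)
Lemma rational_kernel (M : 'M[int]_(m, d)) (w : 'cV[R]_d) :
    w != 0 -> map_mx intr M *m w = 0 ->
  exists2 z : 'cV[int]_d, z != 0 & M *m z = 0.
Proof.
move=> w0 Mw; pose MQ : 'M[rat]_(m, d) := map_mx intr M.
have : cokermx MQ != 0.
  rewrite cokermx_eq0 -(row_full_map (@ratr R)) -map_mx_comp.
  apply: contra w0 => full; apply/eqP/(row_full_inj full); rewrite mulmx0 -Mw.
  by congr (_ *m _); apply: eq_map_mx => z /=; rewrite ratr_int.
case/matrix0Pn => i [j ne].
have [y My {j}ne] : exists2 y : 'cV_d, MQ *m y = 0 & y i 0 != 0.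
  exists (col j (cokermx MQ)); last by rewrite mxE.
  by rewrite colE mulmxA mulmx_coker mul0mx.
pose D := \prod_k denq (y k 0).
have D0 : D%:~R != 0 :> rat.
  by rewrite intr_eq0; apply/prodf_neq0 => k _; rewrite denq_neq0.
pose z : 'cV[int]_d := \col_k (numq (y k 0) * \prod_(l | l != k) denq (y l 0)).
have zE : map_mx intr z = D%:~R *: y.
  apply/colP => k; rewrite !mxE {1}/D [in RHS](bigD1 k) //= !intrM numqE.
  by rewrite [RHS]mulrAC; congr (_ * _); exact: mulrC.
exists z.
  apply/eqP => z0; move/colP/(_ i): zE; rewrite z0 !mxE => /esym/eqP.
  by rewrite mulf_eq0 (negPf D0) (negPf ne).
have : map_mx intr (M *m z) = 0 :> 'M[rat]_(m, 1).
  by rewrite map_mxM /= zE -scalemxAr My scaler0.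
move: (M *m z) => X /matrixP EX; apply/matrixP => k l.
by have /eqP := EX k l; rewrite !mxE intr_eq0 => /eqP.
Qed.

Lemma primitive_ray (M : 'M[int]_(m, d)) (w : 'cV[R]_d) :
    w != 0 -> map_mx intr M *m w = 0 ->
    (forall y, map_mx intr M *m y = 0 -> exists c, y = c *: w) ->
  exists2 z, primitive z & exists2 c, 0 < c & to_real R z = c *: w.
Proof.
move=> w0 Mw line; have [z z0 Mz] := rational_kernel w0 Mw.
have prim (y : 'cV[int]_d) c : y != 0 -> 0 < c -> to_real R y = c *: w ->
    exists2 z, primitive z & exists2 c, 0 < c & to_real R z = c *: w.
  move=> y0 c0 E; have [z' [k [pz' Ez]]] := primitive_divisor y0.
  have k0 : (0 < k)%N by rewrite lt0n; apply: contraNneq y0 => k0; rewrite Ez k0.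
  exists z' => //; exists (k%:R^-1 * c); first by rewrite mulr_gt0 // invr_gt0 ltr0n.
  rewrite -scalerA -E Ez; apply/colP => i; rewrite !mxE mulmxnE.
  rewrite -[z' i 0 *+ k]mulr_natl intrM natz -pmulrn mulKf // pnatr_eq0 -lt0n; exact: k0.
have [|c E] := line (to_real R z).
  rewrite /to_real -map_mxM Mz; apply/matrixP => k l; by rewrite !mxE.
have [c0|c0|c0] := ltrgtP 0 c; first exact: prim E.
  apply: (prim (- z) (- c)); rewrite ?oppr_eq0 ?oppr_gt0 //.
  by rewrite scaleNr -E; apply/colP => i; rewrite !mxE intrN.
case/negP: z0; apply/eqP/colP => i; move/colP/(_ i): E.
by rewrite -c0 scale0r !mxE => /eqP; rewrite intr_eq0 => /eqP.
Qed.

End Rational.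

(** * The normal fan of a lattice polytope *)

Lemma dotv_self0 (R : realType) d (y : 'cV[R]_d) : dotv y y = 0 -> y = 0.
Proof.
move/eqP; rewrite psumr_eq0 => [/allP Z|i _]; last exact: sqr_ge0.
apply/colP => i; rewrite mxE; apply/eqP.
by have := Z i (mem_index_enum _); rewrite mulf_eq0 orbb.
Qed.

(** A maximal free family in [A] spans [A], and with an interior point it spans the whole space. *)
Lemma span_dim_interior (R : realType) d (A : set 'cV[R]_d) w :
    A w -> (forall z, exists2 e, 0 < e & A (w + e *: z)) -> span_dim A d.
Proof.
move=> Aw int.
pose fam k := `[< exists X : k.-tuple 'cV[R]_d, free X /\ forall x, x \in X -> A x >].
have fam0 : exists k, fam k by exists 0%N; apply/asboolP; exists [tuple]; rewrite nil_free.
have le_fam k : fam k -> (k <= d)%N.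
  move=> /asboolP[X [/eqP frX _]]; have := dimvS (subvf <<X>>).
  by rewrite frX size_tuple dimvf /dim /= muln1.
case: (ex_maxnP fam0 le_fam) => k /asboolP[X [frX AX]] maxk.
have spanA x : A x -> x \in <<X>>%VS.
  move=> Ax; apply/negPn/negP => xX.
  suff /maxk : fam k.+1 by rewrite ltnn.
  apply/asboolP; exists [tuple of x :: X]; split; first by rewrite free_cons xX frX.
  by move=> y; rewrite inE => /predU1P[->//|]; exact: AX.
have full : <<X>>%VS = fullv.
  apply/vspaceP => z; rewrite memvf; have [e e0 Aez] := int z.
  have : e *: z \in <<X>>%VS by rewrite -(addKr w (e *: z)) rpredD ?rpredN ?spanA.
  by rewrite rpredZeq gt_eqF.
have kd : k = d.
  by have := eqP frX; rewrite full dimvf size_tuple /dim /= muln1.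
by subst k; exists X.
Qed.

Section Polytope.
Variables (R : realType) (d : nat) (V : seq 'cV[int]_d).
Local Notation "v %:r" := (to_real R v) (at level 2, format "v %:r").
Let P : set 'cV[R]_d := convex_hull [set to_real R v | v in [set` V]].
Implicit Types (w x y : 'cV[R]_d) (v : 'cV[int]_d).

Definition minimizes w v := (v \in V) && all (fun v' => dotv w v%:r <= dotv w v'%:r) V.

Lemma minimizesP w v :
  reflect (v \in V /\ forall v', v' \in V -> dotv w v%:r <= dotv w v'%:r) (minimizes w v).
Proof. by apply: (iffP andP) => -[vV /allP]. Qed.

Lemma hull_vertex v : v \in V -> P v%:r.
Proof.
move=> vV; exists 1%N, (fun=> 1), (fun=> v%:r); split=> //; first by rewrite big_ord1.
  by move=> _; exists v.
by rewrite big_ord1 scale1r.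
Qed.

Lemma hull_ge w c x : (forall v, v \in V -> c <= dotv w v%:r) -> P x -> c <= dotv w x.
Proof.
move=> Hc [k [a [p [a0 a1 pV ->]]]]; rewrite dotv_sumr -[c]mul1r -a1 mulr_suml.
apply: ler_sum => j _; rewrite dotvZr ler_wpM2l //.
by have [v /= vV <-] := pV j; exact: Hc.
Qed.

Hypothesis fullP : full_dimensional P.

Lemma hull_nonempty : exists v, v \in V.
Proof.
have [x0 [k [a [p [_ a1 pV _]]]] _] := fullP.
case: k => [|k] in a p a1 pV *; first by move/eqP: a1; rewrite big_ord0 eq_sym oner_eq0.
by have [v vV _] := pV ord0; exists v.
Qed.

(** Differences of points of [P] are orthogonal to [y] and span the space, so [y] is orthogonal to
    itself. *)
Lemma hull_separates y :
  (forall v v', v \in V -> v' \in V -> dotv y v%:r = dotv y v'%:r) -> y = 0.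
Proof.
move=> cst; have [v0 v0V] := hull_nonempty.
have cstP x : P x -> dotv y x = dotv y v0%:r.
  move=> Px; apply/eqP; rewrite eq_le; apply/andP; split.
    have := @hull_ge (-1 *: y) (- dotv y v0%:r) x; rewrite dotvZl mulN1r lerN2; apply=> //.
    by move=> v vV; rewrite dotvZl mulN1r (cst v v0).
  by apply: hull_ge Px => v vV; rewrite (cst v v0).
have [x0 Px0 [X [frX AX _]]] := fullP.
have full : <<X>>%VS = fullv.
  by apply/eqP; rewrite eqEdim subvf dimvf (eqP frX) size_tuple /dim /= muln1.
apply: dotv_self0.
have /coord_span E : y \in <<X>>%VS by rewrite full memvf.
rewrite {2}E dotv_sumr big1 // => i _; rewrite dotvZr.
have [|x Px <-] := AX X`_i; first by apply: mem_nth; rewrite size_tuple.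
by rewrite dotvBr !cstP // subrr mulr0.
Qed.

Lemma minimizer_ex w : exists v, minimizes w v.
Proof.
have [v0 v0V] := hull_nonempty.
have [v vV Hv] := seq_argmin (fun v => dotv w v%:r) v0V.
by exists v; apply/minimizesP.
Qed.

(* The cone of the normal fan that contains w in its relative interior. *)
Definition cone_at w := normal_cone P [set x | P x /\ forall y, P y -> dotv w x <= dotv w y].

Lemma minimizes_hull w v : minimizes w v -> forall y, P y -> dotv w v%:r <= dotv w y.
Proof. by case/minimizesP => vV Hv y; apply: hull_ge. Qed.

(** A convex combination lying on the face of [w] puts weight only on minimizing points of [V], so
    normal cones become finitely many comparisons. *)
Lemma cone_atP w w' : cone_at w w' <->
  forall v, minimizes w v -> minimizes w' v.
Proof.
split=> [H v mv|H x [[k [a [p [a0 a1 pV ->]]]] Hx] y Py].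
  have vV : v \in V by case/minimizesP: mv.
  apply/minimizesP; split=> // v' v'V; apply: H (hull_vertex v'V).
  by split; [exact: hull_vertex | exact: minimizes_hull].
have [v0 mv0] := minimizer_ex w.
have v0V : v0 \in V by case/minimizesP: mv0.
have z j : a j * (dotv w (p j) - dotv w v0%:r) = 0.
  have ge0 i : 0 <= a i * (dotv w (p i) - dotv w v0%:r).
    have [v vV <-] := pV i; rewrite mulr_ge0 // subr_ge0.
    exact: minimizes_hull mv0 _ (hull_vertex vV).
  have := Hx _ (hull_vertex v0V); rewrite dotv_sumr -subr_le0.
  have -> : \sum_i dotv w (a i *: p i) - dotv w v0%:r =
     \sum_i a i * (dotv w (p i) - dotv w v0%:r).
    rewrite -[X in _ - X]mul1r -a1 mulr_suml -sumrB; apply: eq_bigr => i _.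
    by rewrite dotvZr mulrBr.
  move=> le0; have /eqP : \sum_i a i * (dotv w (p i) - dotv w v0%:r) = 0.
    by apply/eqP; rewrite eq_le le0 sumr_ge0.
  by rewrite psumr_eq0 // => /allP/(_ j (mem_index_enum _))/eqP.
rewrite dotv_sumr -[dotv w' y]mul1r -a1 mulr_suml; apply: ler_sum => j _.
rewrite dotvZr; have [->|aj] := eqVneq (a j) 0; first by rewrite !mul0r.
rewrite ler_wpM2l //; have [v vV Ev] := pV j; rewrite -Ev.
apply: minimizes_hull Py; apply: H; apply/minimizesP; split=> // v' v'V.
move/eqP: (z j); rewrite mulf_eq0 (negPf aj) subr_eq0 -Ev => /eqP->.
by case/minimizesP: mv0 => _; exact.
Qed.

Lemma cone_at_fan w : normal_fan P (cone_at w).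
Proof.
eexists; last by []; split; last by exists w.
have [v mv] := minimizer_ex w; exists v%:r; split; last exact: minimizes_hull.
by apply: hull_vertex; case/minimizesP: mv.
Qed.

Lemma perturb w y v : exists2 e, 0 < e & forall v', v' \in V ->
  dotv w v%:r < dotv w v'%:r -> dotv (w + e *: y) v%:r < dotv (w + e *: y) v'%:r.
Proof.
(* The induction on [V] shrinks [e], so the claim has to hold for all smaller values too. *)
suff [e e0 He] : exists2 e, 0 < e & forall e', 0 < e' -> e' <= e -> forall v', v' \in V ->
    dotv w v%:r < dotv w v'%:r -> dotv (w + e' *: y) v%:r < dotv (w + e' *: y) v'%:r.
  by exists e => //; apply: He.
elim: V => [|u s [e e0 He]]; first by exists 1.
have [lt|ge] := ltP (dotv w v%:r) (dotv w u%:r); last first.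
  exists e => // e' e'0 le v'; rewrite inE => /predU1P[->|/He]; last exact.
  by rewrite ltNge ge.
pose g := dotv w u%:r - dotv w v%:r; pose h := `|dotv y v%:r - dotv y u%:r| + 1.
have g0 : 0 < g by rewrite subr_gt0.
have h0 : 0 < h by rewrite ltr_wpDl.
exists (Num.min e (g / h)) => [|e' e'0]; first by rewrite lt_min e0 divr_gt0.
rewrite le_min => /andP[le1 le2] v'; rewrite inE => /predU1P[-> _|/He]; last exact.
rewrite !dotvDl !dotvZl -subr_gt0; move: le2; rewrite ler_pdivlMr // => le2.
have : e' * (dotv y v%:r - dotv y u%:r) < e' * h.
  by rewrite ltr_pM2l // /h ltr_pwDr // ler_norm.
by rewrite /g in le2; rewrite mulrBr; lra.
Qed.

Definition exposed v := exists w, forall v', minimizes w v' <-> v' = v.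

(** Tilting [w] slightly along the difference [v - v'] of two minimizers creates no new minimizer
    and discards [v]; this is repeated until one is left. *)
Lemma exposed_cover w : exists2 v, exposed v & minimizes w v.
Proof.
move: {2}(count (minimizes w) V).+1 (ltnSn (count (minimizes w) V)) => m.
elim: m w => // m IH w lt.
have [v mv] := minimizer_ex w.
have [uniq|] := pselect (forall v', minimizes w v' -> v' = v).
  by exists v => //; exists w => v'; split=> [/uniq|->].
move=> /existsNP[v' /not_implyP[mv' ne]].
have [e e0 He] := perturb w (v%:r - v'%:r) v; set w' := w + _ in He.
have sub u : minimizes w' u -> minimizes w u.
  case/minimizesP => uV Hu; apply/minimizesP; split=> // u' u'V.
  apply: (@le_trans _ _ (dotv w v%:r)); last by case/minimizesP: mv => _; exact.
  rewrite leNgt; apply/negP => /(He _ uV); rewrite ltNge Hu //.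
  by case/minimizesP: mv.
have [|u ex mu] := IH w'; last by exists u => //; exact: sub.
rewrite ltnS in lt; apply: leq_trans lt.
have [vV Hv] := minimizesP _ _ mv; have [v'V Hv'] := minimizesP _ _ mv'.
apply: (ltn_count (x := v)) => // [u _|]; first exact: sub.
apply/negP => /minimizesP[_ /(_ _ v'V)]; apply/negP; rewrite -ltNge.
rewrite !dotvDl !dotvZl (_ : dotv w v%:r = dotv w v'%:r); last first.
  by apply/eqP; rewrite eq_le Hv ?Hv'.
rewrite ltrD2l ltr_pM2l // -subr_gt0 -dotvBr lt0r.
rewrite [0 <= _]sumr_ge0 ?andbT => [|i _]; last exact: sqr_ge0.
apply/negP => /eqP/dotv_self0/subr0_eq E; apply: ne; apply/colP => i.
by move/colP/(_ i)/eqP: E; rewrite !mxE eqr_int => /eqP.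
Qed.

Definition vertex_cone v : set 'cV[R]_d := [set w | minimizes w v].

Lemma exposed_vertex_cone v : exposed v ->
  normal_fan P (vertex_cone v) /\ span_dim (vertex_cone v) d.
Proof.
move=> [w Hw]; have E : vertex_cone v = cone_at w.
  apply/seteqP; split=> w'; rewrite /vertex_cone /=.
    by move=> m; apply/cone_atP => v' /Hw->.
  by move/cone_atP; apply; exact/Hw.
split; first by rewrite E; exact: cone_at_fan.
have mv : minimizes w v by exact/Hw.
have [vV Hv] := minimizesP _ _ mv.
apply: (@span_dim_interior _ _ _ w) => // z.
have [e e0 He] := perturb w z v; exists e => //; apply/minimizesP; split=> // v' v'V.
have [->//|ne] := eqVneq v' v; apply/ltW/He => //.
rewrite lt_neqAle Hv // andbT; apply: contra_neq ne => E'.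
by apply/Hw/minimizesP; split=> // u uV; rewrite -E' Hv.
Qed.

Section VertexCone.
Variables (v : 'cV[int]_d) (vV : v \in V).
Implicit Type C : set 'cV[R]_d.

Lemma vertex_coneP w :
  vertex_cone v w <-> forall v', v' \in V -> 0 <= dotv w (v'%:r - v%:r).
Proof.
rewrite /vertex_cone /=; split=> [/minimizesP[_ H] v' /H|H].
  by rewrite dotvBr subr_ge0.
by apply/minimizesP; split=> // v' /H; rewrite dotvBr subr_ge0.
Qed.

Lemma vertex_cone_ge0 w v' : vertex_cone v w -> v' \in V -> 0 <= dotv w (v'%:r - v%:r).
Proof. by move/vertex_coneP; apply. Qed.

Lemma tight_minimizes w v' : vertex_cone v w -> v' \in V ->
  dotv w (v'%:r - v%:r) = 0 -> minimizes w v'.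
Proof.
move=> /minimizesP[_ H] v'V; rewrite dotvBr => /subr0_eq E.
by apply/minimizesP; split=> // u uV; rewrite E H.
Qed.

(** The last hypothesis says that [w] spans an edge of the vertex cone. The equations tight at [w]
    are integral, so the edge contains a primitive vector. *)
Lemma edge_ray_generator w : vertex_cone v w -> w != 0 ->
    (forall y, (forall v', v' \in V -> dotv w (v'%:r - v%:r) = 0 ->
                 dotv y (v'%:r - v%:r) = 0) -> exists c, y = c *: w) ->
  exists z c, [/\ ray_generators_in (normal_fan P) (vertex_cone v) z, 0 < c
    & z%:r = c *: w].
Proof.
move=> cw w0 line.
(* Rows of inequalities that are not tight at [w] are set to zero. *)
pose M : 'M[int]_(size V, d) := \matrix_(i, j)
  (if dotv w ((V`_i)%:r - v%:r) == 0 then (V`_i - v) j 0 else 0).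
have ME y (i : 'I_(size V)) : (map_mx intr M *m y) i 0 =
    if dotv w ((V`_i)%:r - v%:r) == 0 then dotv y ((V`_i)%:r - v%:r) else 0.
  rewrite mxE; case: ifP => E; last by apply: big1 => j _; rewrite !mxE E mul0r.
  by apply: eq_bigr => j _; rewrite !mxE E mulrC intrB.
have ker y : map_mx intr M *m y = 0 <-> (forall v', v' \in V ->
    dotv w (v'%:r - v%:r) = 0 -> dotv y (v'%:r - v%:r) = 0).
  split=> [My v' v'V E|H].
    have := ME y (Ordinal (etrans (index_mem v' V) v'V)).
    by rewrite My /= nth_index // E eqxx mxE.
  apply/colP => i; rewrite ME mxE; case: eqP => // E; apply: H => //.
  exact: mem_nth.
have [||z pz [c c0 Ez]] := @primitive_ray _ _ _ M w w0.
- by apply/ker.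
- by move=> y /ker /line.
exists z, c; split=> //; split=> //; exists (cone_at w); split.
- exact: cone_at_fan.
- exists [tuple w]; split=> [|x|x]; first by rewrite free_cons span_nil memv0 w0 nil_free.
    by rewrite inE => /eqP->; apply/cone_atP.
  move/cone_atP => Hx; rewrite span_seq1.
  have [|k ->] := line x; last by rewrite memvZ ?memv_line.
  move=> v' v'V /(tight_minimizes cw v'V) /Hx /minimizesP[_ /(_ v vV)] h1.
  have /minimizesP[_ /(_ v' v'V) h2] := Hx v cw.
  by rewrite dotvBr; apply/eqP; rewrite subr_eq0 eq_le h1 h2.
- by move=> x /cone_atP; apply.
- rewrite Ez; apply/cone_atP => u /minimizesP[uV Hu]; apply/minimizesP; split=> // u' u'V.
  by rewrite !dotvZl ler_pM2l // Hu.
Qed.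

(* Minkowski-Weyl for the cone of a vertex: unless w spans an edge of the
   cone, it is a sum of two elements with more tight inequalities. *)
Lemma vertex_cone_sub C : C 0 -> (forall x y, C x -> C y -> C (x + y)) ->
    (forall c x, 0 <= c -> C x -> C (c *: x)) ->
    (forall z, ray_generators_in (normal_fan P) (vertex_cone v) z -> C z%:r) ->
  vertex_cone v `<=` C.
Proof.
move=> C0 CD CZ Cray w.
pose loose w v' := dotv w (v'%:r - v%:r) != 0.
move: {2}(count (loose w) V).+1 (ltnSn (count (loose w) V)) => m.
elim: m w => // m IH w lt cw.
have [->//|w0] := eqVneq w 0.
have [line|] := pselect (forall y, (forall v', v' \in V ->
    dotv w (v'%:r - v%:r) = 0 -> dotv y (v'%:r - v%:r) = 0) -> exists c, y = c *: w).
  have [z [c [/Cray Cz c0 Ez]]] := edge_ray_generator cw w0 line.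
  have -> : w = c^-1 *: z%:r by rewrite Ez scalerK // gt_eqF.
  by apply: CZ => //; rewrite invr_ge0 ltW.
move=> /existsNP[y /not_implyP[Hy nline]].
(* The minimal ratio [c] is the largest multiple of [w] that can be subtracted from [x] within the
   cone; the point [u] attaining it becomes tight. *)
have step x : (forall v', v' \in V -> dotv w (v'%:r - v%:r) = 0 -> dotv x (v'%:r - v%:r) = 0) ->
    exists c, vertex_cone v (x - c *: w) /\ C (x - c *: w).
  move=> Hx.
  have [u] : exists u, u \in [seq u <- V | loose w u].
    apply: contrapT => none; case/eqP: w0; apply: hull_separates => u u' uV u'V.
    suff E t : t \in V -> dotv w t%:r = dotv w v%:r by rewrite !E.
    move=> tV; apply/eqP; rewrite -subr_eq0 -dotvBr; apply/negPn/negP => lt'.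
    by apply: none; exists t; rewrite mem_filter /loose lt'.
  move/(seq_argmin (fun u => dotv x (u%:r - v%:r) / dotv w (u%:r - v%:r))) => {u}[u].
  rewrite mem_filter => /andP[lu uV] Hu.
  set c := _ / _ in Hu; exists c.
  have cone : vertex_cone v (x - c *: w).
    apply/vertex_coneP => v' v'V; rewrite dotvBl dotvZl subr_ge0.
    have [E|ne] := eqVneq (dotv w (v'%:r - v%:r)) 0; first by rewrite E Hx // mulr0.
    have gt : 0 < dotv w (v'%:r - v%:r) by rewrite lt_neqAle eq_sym ne vertex_cone_ge0.
    by rewrite -ler_pdivlMr //; apply: Hu; rewrite mem_filter /loose ne.
  split=> //; apply: IH => //.
  rewrite ltnS in lt; apply: leq_trans lt; apply: (ltn_count (x := u)) => //.
    move=> t tV; apply: contra => /eqP E; rewrite dotvBl dotvZl E Hx //.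
    by rewrite mulr0 subrr.
  by rewrite /loose negbK dotvBl dotvZl /c divfK // subrr.
have [c [c1 C1]] := step y Hy.
have [|c' [c2 C2]] := step (- y).
  by move=> v' v'V E; rewrite -scaleN1r dotvZl Hy // mulr0.
have sumE : (y - c *: w) + (- y - c' *: w) = (- (c + c')) *: w.
  by rewrite addrACA subrr add0r -opprD -scalerDl scaleNr.
(* The cone is pointed: for [c + c' = 0] it would contain [y - c *: w] and its opposite, making [y]
   a multiple of [w]; for [c + c' > 0] it would contain [- w]. *)
have gt0 : 0 < - (c + c').
  rewrite lt_neqAle; apply/andP; split.
    apply/negP => /eqP E; apply: nline; exists c; apply/eqP; rewrite -subr_eq0; apply/eqP.
    have E2 : - y - c' *: w = - (y - c *: w).
      by apply/eqP; rewrite -subr_eq0 opprK addrC sumE -E scale0r.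
    suff K t : t \in V -> dotv (y - c *: w) t%:r = dotv (y - c *: w) v%:r.
      by apply: hull_separates => t t' tV t'V; rewrite !K.
    move=> tV; apply/eqP; rewrite eq_le -subr_le0 -[X in _ && X]subr_ge0 -dotvBr.
    rewrite -oppr_ge0; apply/andP; split; last exact: vertex_cone_ge0.
    by rewrite -mulN1r -dotvZl scaleN1r -E2 vertex_cone_ge0.
  apply/negP => /negP; rewrite -ltNge => lt0.
  case/eqP: w0; apply: hull_separates => u u' uV u'V.
  suff E t : t \in V -> dotv w t%:r = dotv w v%:r by rewrite !E.
  move=> tV; apply/eqP; rewrite -subr_eq0 -dotvBr eq_le.
  have /vertex_coneP/(_ t tV) ge := cw; rewrite ge andbT.
  have /vertex_coneP/(_ t tV) h1 := c1; have /vertex_coneP/(_ t tV) h2 := c2.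
  have := addr_ge0 h1 h2; rewrite -dotvDl sumE dotvZl.
  by rewrite nmulr_rge0.
have -> : w = (- (c + c'))^-1 *: ((y - c *: w) + (- y - c' *: w)).
  by rewrite sumE scalerK // gt_eqF.
by apply: CZ; [rewrite invr_ge0 ltW | exact: CD].
Qed.

End VertexCone.
End Polytope.

Lemma col_mulmx (R : pzSemiRingType) m n p (A : 'M[R]_(m, n)) (B : 'M[R]_(n, p)) j :
  col j (A *m B) = A *m col j B.
Proof. by rewrite !colE mulmxA. Qed.

(** * From a smooth polytope to simplicial fan data *)

Section PolytopeFan.
Variables (R : realType) (d n : nat) (V : seq 'cV[int]_d) (F : 'M[int]_(d, n)).
Local Notation "v %:r" := (to_real R v) (at level 2, format "v %:r").
Let P : set 'cV[R]_d := convex_hull [set to_real R v | v in [set` V]].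
Hypotheses (fullP : full_dimensional P) (rayF : ray_matrix (normal_fan P) F).

Lemma primitive_neq0 (v : 'cV[int]_d) : primitive v -> v%:r != 0.
Proof.
move=> pv; suff : v != 0.
  apply: contra_neq => E; apply/colP => i; move/colP/(_ i)/eqP: E.
  by rewrite !mxE intr_eq0 => /eqP.
by apply/eqP => v0; have := pv 2%N 0; rewrite v0 mul0rn => /(_ erefl).
Qed.

(** With [c < 0] the cone would contain [v] and a negative multiple of it, so [v] would be constant
    on the full-dimensional [P]. *)
Lemma fan_ray_sub rho (v : 'cV[int]_d) x : normal_fan P rho -> span_dim rho 1 ->
  primitive v -> rho v%:r -> rho x -> exists2 c, 0 <= c & x = c *: v%:r.
Proof.
move=> [Q [[q Qq] [w QE]] ->] [X [frX _ spanX]] pv rv rx.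
have v0 := primitive_neq0 pv.
have [c E] : exists c, x = c *: v%:r.
  have X1 : <<X>>%VS = <[v%:r]>%VS.
    apply/eqP; rewrite eq_sym eqEdim -memvE spanX // (eqP frX) size_tuple.
    by rewrite dim_vline v0.
  by have := spanX x rx; rewrite X1 => /vlineP.
exists c => //; rewrite leNgt; apply/negP => c0.
case/eqP: v0; apply: (hull_separates fullP) => u u' uV u'V.
suff K t : t \in V -> dotv v%:r t%:r = dotv v%:r q by rewrite !K.
move=> tV; have Pt : P t%:r by exact: hull_vertex.
apply/eqP; rewrite eq_le (rv q Qq _ Pt) andbT.
by have := rx q Qq _ Pt; rewrite E !dotvZl ler_nM2l.
Qed.

Lemma Zbasis_inverse m (b : 'M[int]_(d, m)) :
    (forall v, exists! c : 'cV[int]_m, v = b *m c) ->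
  exists2 b' : 'M[int]_(m, d), b *m b' = 1%:M & b' *m b = 1%:M.
Proof.
move=> Hb; have /choice[f Hf] : forall j : 'I_d, exists c, col j 1%:M = b *m c.
  by move=> j; have [c [E _]] := Hb (col j 1%:M); exists c.
pose b' := \matrix_(i, j) f j i 0.
have bb' : b *m b' = 1%:M.
  apply/matrixP => i j; have /colP/(_ i) := Hf j; rewrite 2!mxE => ->.
  by rewrite !mxE; apply: eq_bigr => k _; rewrite mxE.
exists b' => //; apply/matrixP => i j.
have [c [_ uc]] := Hb (b *m col j 1%:M).
have : col j (b' *m b) = col j 1%:M.
  rewrite -(uc (col j 1%:M)) // -(uc (col j (b' *m b))) //.
  by rewrite col_mulmx !mulmxA bb' mul1mx -col_mulmx mulmx1.
by move/colP/(_ i); rewrite !mxE.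
Qed.

Section Vertex.
Variables (v : 'cV[int]_d) (vV : v \in V).
Let S := ray_generators_in (normal_fan P) (@vertex_cone R d V v).
Let I : pred 'I_n := fun j => `[< @vertex_cone R d V v (col j F)%:r >].

Lemma ray_generator_col z : S z -> exists2 j, I j & z = col j F.
Proof.
move=> [pz [rho [r1 r2 r3 r4]]]; have [_ rayE] := rayF.
have : ray_generators_in (normal_fan P) setT z by split=> //; exists rho; split.
rewrite -rayE => -[j _ E]; exists j => //; apply/asboolP; rewrite E; exact: r3.
Qed.

Lemma col_ray_generator j : I j -> S (col j F).
Proof.
move=> /asboolP Ij; have [_ rayE] := rayF.
have : ray_generators_in (normal_fan P) setT (col j F) by rewrite -rayE; exists j.
move=> [pz [rho [r1 r2 _ r4]]]; split=> //; exists rho; split=> // x.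
move/(fan_ray_sub r1 r2 pz r4) => [c c0 ->]; apply/(vertex_coneP vV _) => v' v'V.
by rewrite dotvZl mulr_ge0 // (vertex_cone_ge0 vV).
Qed.

Lemma vertex_cone_conic : @vertex_cone R d V v = conic F I.
Proof.
apply/seteqP; split=> [|w].
  apply: (vertex_cone_sub fullP vV).
  - by exists (fun=> 0); split=> //; rewrite big1 // => j _; rewrite scale0r.
  - move=> _ _ [l [l0 lo ->]] [m [m0 mo ->]]; exists (fun j => l j + m j); split.
    + by move=> j; rewrite addr_ge0.
    + by move=> j Ij; rewrite lo // mo // addr0.
    + by rewrite -big_split; apply: eq_bigr => j _; rewrite scalerDl.
  - move=> c _ c0 [l [l0 lo ->]]; exists (fun j => c * l j); split.
    + by move=> j; rewrite mulr_ge0.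
    + by move=> j Ij; rewrite lo // mulr0.
    + by rewrite scaler_sumr; apply: eq_bigr => j _; rewrite scalerA.
  - move=> z /ray_generator_col[j Ij ->]; exists (fun l => (l == j)%:R); split.
    + by move=> l; rewrite ler0n.
    + by move=> l; apply: contraNeq; rewrite pnatr_eq0 eqb0 negbK => /eqP->.
    + rewrite (bigD1 j) //= eqxx scale1r big1 ?addr0 // => l /negPf->.
      by rewrite scale0r.
move=> [l [l0 lo ->]]; apply/(vertex_coneP vV _) => v' v'V.
rewrite dotv_suml sumr_ge0 // => j _; rewrite dotvZl.
have [/asboolP Ij|/lo->] := boolP (I j); last by rewrite mul0r.
by rewrite mulr_ge0 // (vertex_cone_ge0 vV).
Qed.

Lemma dual_basis : is_Zbasis S -> exists G : 'M[int]_(d, n),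
  [/\ G *m F^T = 1%:M, forall j l, I j -> (F^T *m G) j l = (j == l)%:R
    & forall x l, ~~ I l -> G x l = 0].
Proof.
move=> [m [b [SE /Zbasis_inverse[b' bb' b'b]]]].
have [injF _] := rayF.
have /choice[f Hf] : forall i : 'I_m, exists j, I j /\ col i b = col j F.
  move=> i; have /ray_generator_col[j Ij E] : S (col i b) by rewrite SE; exists i.
  by exists j.
(* [E] selects the columns of [F] that make up [b]; composed with the inverse of [b] it places the
   dual basis in the columns of [I] and zeros elsewhere. *)
pose E : 'M[int]_(n, m) := \matrix_(l, i) (f i == l)%:R.
have FE : F *m E = b.
  apply/matrixP => x i; rewrite mxE (bigD1 (f i)) //= big1 => [|l /negPf ne].
    have [_ /colP/(_ x)] := Hf i; rewrite !mxE eqxx mulr1 addr0; exact: esym.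
  by rewrite mxE eq_sym ne mulr0.
exists (E *m b')^T; split.
- by rewrite -trmx_mul mulmxA FE bb' trmx1.
- move=> j l Ij; rewrite -trmx_mul mxE.
  have [i _ Ei] : range (fun i => col i b) (col j F) by rewrite -SE; exact: col_ray_generator.
  have fij : f i = j by apply: injF => /=; have [_ E2] := Hf i; rewrite -E2.
  transitivity (col j (E *m b' *m F) l 0); first by rewrite [RHS]mxE.
  rewrite col_mulmx -Ei -col_mulmx -mulmxA b'b mulmx1.
  by rewrite !mxE fij.
- move=> x l Il; rewrite !mxE big1 // => i _; rewrite mxE.
  have [Ii _] := Hf i; case: eqP => [E'|]; last by rewrite mul0r.
  by move: Il; rewrite -E' Ii.
Qed.

End Vertex.

Lemma polytope_fan : smooth_fan (normal_fan P) ->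
  exists N (I : 'I_N -> pred 'I_n) (G : 'I_N -> 'M[int]_(d, n)) a,
  [/\ simplicial_fan R F I G a, P `<=` facet_polytope F a
    & forall i, P (to_real R (vertex G i a))].
Proof.
move=> smooth.
pose W := [seq v <- V | `[< @exposed R d V v >]].
have WP (i : 'I_(size W)) : W`_i \in V /\ @exposed R d V W`_i.
  have : W`_i \in W by apply: mem_nth.
  by rewrite mem_filter => /andP[/asboolP].
pose I (i : 'I_(size W)) : pred 'I_n := fun j => `[< @vertex_cone R d V W`_i (col j F)%:r >].
have /choice[G HG] : forall i, exists G : 'M[int]_(d, n),
  [/\ G *m F^T = 1%:M, forall j l, I i j -> (F^T *m G) j l = (j == l)%:R
    & forall x l, ~~ I i l -> G x l = 0].
  move=> i; have [iV iX] := WP i.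
  have [c1 c2] := exposed_vertex_cone fullP iX.
  exact: dual_basis iV (smooth _ c1 c2).
have /choice[f Hf] : forall j : 'I_n, exists v, minimizes V (col j F)%:r v.
  by move=> j; exact: minimizer_ex.
(* Minus the minimum over [P] of each ray generator, so every facet inequality is sharp and
   [vertex G i a] is the original vertex. *)
pose a : 'cV[int]_n := \col_j - (F^T *m f j) j 0.
have aE j : (a j 0)%:~R = - dotv (col j F)%:r (f j)%:r.
  by rewrite mxE intrN dotv_col.
have dV (i : 'I_(size W)) j : (a + F^T *m W`_i) j 0 = 0 <-> I i j.
  have [iV _] := WP i; have /minimizesP[fV Hfj] := Hf j.
  have E : ((a + F^T *m W`_i) j 0)%:~R = dotv (col j F)%:r (W`_i)%:r - dotv (col j F)%:r (f j)%:r.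
    by rewrite [in LHS]mxE intrD aE [in RHS]dotv_col addrC.
  split=> [E0|/asboolP/minimizesP[_ Ij]].
    apply/asboolP/minimizesP; split=> // v vV.
    by move: E; rewrite E0 => /esym/subr0_eq->; exact: Hfj.
  apply/eqP; rewrite -(intr_eq0 R) E subr_eq0 eq_le Ij //; exact: Hfj.
have vE (i : 'I_(size W)) : vertex G i a = W`_i.
  have [h1 h2 h3] := HG i; rewrite /vertex.
  have : G i *m (a + F^T *m W`_i) = 0.
    apply/colP => x; rewrite mxE [RHS]mxE big1 // => j _.
    by have [/dV->|/h3->] := boolP (I i j); rewrite ?mulr0 ?mul0r.
  by rewrite mulmxDr mulmxA h1 mul1mx => /eqP; rewrite addr_eq0 => /eqP->; rewrite opprK.
have Pa : P `<=` facet_polytope F a.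
  move=> x Px j; rewrite aE subr_ge0; apply: hull_ge Px => v vV.
  by have /minimizesP[_] := Hf j; exact.
exists (size W), I, G, a; split=> // [|i]; last first.
  by rewrite vE; apply: hull_vertex; have [] := WP i.
split.
- by move=> i; have [] := HG i.
- by move=> i j l; have [_ h _] := HG i; exact: h.
- by move=> i x l; have [_ _ h] := HG i; exact: h.
- move=> w; have [v ex mv] := exposed_cover fullP w.
  have vV : v \in V by case/minimizesP: mv.
  have vW : v \in W by rewrite mem_filter vV andbT; exact/asboolP.
  exists (Ordinal (etrans (index_mem v W) vW)).
  by rewrite -vertex_cone_conic ?nth_index //; have [] := WP (Ordinal (etrans (index_mem v W) vW)).
- move=> i j; have [iV _] := WP i.
  by rewrite -vertex_cone_conic // => ?; exact/asboolP.
- move=> i j Ij; rewrite slackE vE; have [iV _] := WP i.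
  rewrite lt_neqAle; apply/andP; split.
    by apply: contra Ij => /eqP/esym/dV.
  have := Pa _ (hull_vertex R iV) j; rewrite dotv_col -intrD ler0z.
  by rewrite addrC [X in _ -> (_ <= X)]mxE.
Qed.

End PolytopeFan.

(** * Coprimality and Newton polytopes of positive polynomials *)

Section Nonneg.
Variables (K : numDomainType) (d : nat).
Implicit Types p q : {mpoly K[d]}.

Definition nonneg_mpoly p := forall m, 0 <= p@_m.

Lemma nonneg_mpolyD p q : nonneg_mpoly p -> nonneg_mpoly q -> nonneg_mpoly (p + q).
Proof. by move=> hp hq m; rewrite mcoeffD addr_ge0. Qed.

Lemma nonneg_mpolyM p q : nonneg_mpoly p -> nonneg_mpoly q -> nonneg_mpoly (p * q).
Proof. by move=> hp hq m; rewrite mcoeffM sumr_ge0 // => k _; rewrite mulr_ge0. Qed.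

Lemma nonneg_mpolyX m : nonneg_mpoly 'X_[m].
Proof. by move=> k; rewrite mcoeffX ler0n. Qed.

Lemma nonneg_mpolyZ c p : 0 <= c -> nonneg_mpoly p -> nonneg_mpoly (c *: p).
Proof. by move=> c0 hp m; rewrite mcoeffZ mulr_ge0. Qed.

Lemma nonneg_mpoly1 : nonneg_mpoly 1.
Proof. by move=> m; rewrite mcoeff1 ler0n. Qed.

Lemma nonneg_mpoly_sum (I : Type) (r : seq I) (P : pred I) (f : I -> {mpoly K[d]}) :
  (forall i, P i -> nonneg_mpoly (f i)) -> nonneg_mpoly (\sum_(i <- r | P i) f i).
Proof.
move=> Hf; elim/big_ind: _ => //; first by move=> m; rewrite mcoeff0.
exact: nonneg_mpolyD.
Qed.

(* No cancellation: the supports of nonnegative polynomials add up. *)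
Lemma nonneg_mpolyM_gt0 p q m k : nonneg_mpoly p -> nonneg_mpoly q ->
  0 < p@_m -> 0 < q@_k -> 0 < (p * q)@_(m + k)%MM.
Proof.
move=> hp hq pm qk.
have rest (f : {mpoly K[d]}) l : nonneg_mpoly f -> nonneg_mpoly (f - f@_l *: 'X_[l]).
  move=> hf x; rewrite mcoeffB mcoeffZ mcoeffX.
  by case: eqP => [->|_]; rewrite ?mulr1 ?subrr // mulr0 subr0.
have -> : p * q = (p@_m * q@_k) *: 'X_[m + k] +
    (p@_m *: 'X_[m] * (q - q@_k *: 'X_[k]) + (p - p@_m *: 'X_[m]) * q).
  rewrite mpolyXD mulrBl mulrBr -scalerAl -scalerAl -scalerAr scalerA.
  by ring.
rewrite mcoeffD mcoeffZ mcoeffX eqxx mulr1 ltr_pwDl ?mulr_gt0 //.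
apply: nonneg_mpolyD; apply: nonneg_mpolyM => //; try exact: rest.
by apply: nonneg_mpolyZ; [exact: ltW | exact: nonneg_mpolyX].
Qed.

End Nonneg.

Section Curve.
Variables (R : realType) (d : nat).
Local Notation C := R[i].
Implicit Types p q g : {mpoly C[d]}.

(* The curve t_i = (s - i)^2: it meets the coordinate hyperplanes at distinct
   real points, where the other coordinates are positive, and restricting a
   polynomial with nonnegative coefficients to it doubles the degree. *)
Definition curve p : {poly C} := mmap (@polyC C) (fun i : 'I_d => ('X - (i%:R)%:P) ^+ 2) p.

Lemma curveM : {morph curve : p q / p * q}.
Proof. by move=> p q; rewrite /curve rmorphM. Qed.

Lemma curveE p z : (curve p).[z] = p.@[fun i => (z - i%:R) ^+ 2].
Proof.
rewrite /curve /mmap horner_sum mevalE; apply: eq_bigr => m _.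
rewrite hornerCM /mmap1 horner_prod; congr (_ * _); apply: eq_bigr => i _.
by rewrite !horner_exp hornerXsubC.
Qed.

Lemma curve_monomial m :
  let w := mmap1 (fun i : 'I_d => ('X - (i%:R)%:P : {poly C}) ^+ 2) m in
  w \is monic /\ size w = (mdeg m).*2.+1.
Proof.
rewrite /mmap1 mdegE.
elim/big_rec2: _ => [|i k w _ [wm ws]]; first by rewrite monic1 size_poly1.
have Xm : (('X - (i%:R)%:P : {poly C}) ^+ 2) ^+ m i \is monic.
  by do 2!apply: monic_exp; exact: monicXsubC.
split; first by rewrite monicMl.
rewrite size_monicM // ?monic_neq0 // ws -exprM size_exp_XsubC.
by rewrite addSn doubleD addnS /= -[(m i).*2]mul2n.
Qed.

Lemma size_curve_le p : (size (curve p) <= (msize p).-1.*2.+1)%N.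
Proof.
rewrite /curve /mmap; apply: (leq_trans (size_sum _ _ _)).
apply/bigmax_leqP_seq => m mp _; rewrite mul_polyC.
apply: (leq_trans (size_scale_leq _ _)).
have [_ ->] := curve_monomial m; rewrite ltnS leq_double.
by have := msize_mdeg_lt mp; case: (msize p).
Qed.

(** Monomials restrict to monic polynomials of twice their degree, so leading coefficients add up
    without cancellation. *)
Lemma size_curve p : nonneg_mpoly p -> p != 0 -> size (curve p) = (msize p).-1.*2.+1.
Proof.
move=> hp p0; apply/eqP; rewrite eqn_leq size_curve_le /=.
rewrite ltnNge; apply/negP => /leq_sizeP/(_ _ (leqnn _))/eqP; apply/negP.
apply: lt0r_neq0.
rewrite /curve /mmap coef_sum (bigD1_seq (mlead p)) ?msupp_uniq ?mlead_supp //=.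
have dl : mdeg (mlead p) = (msize p).-1 by rewrite -mlead_deg.
rewrite ltr_pwDl //.
  have [/monicP wm ws] := curve_monomial (mlead p).
  rewrite coefCM -dl; move: wm; rewrite /lead_coef ws /= => ->.
  by rewrite mulr1 lt0r hp mleadc_eq0 p0.
rewrite big_seq_cond sumr_ge0 // => m /andP[mp _]; rewrite coefCM mulr_ge0 //.
have [/monicP wm ws] := curve_monomial m.
have [E|ne] := eqVneq (mdeg m) (msize p).-1.
  by move: wm; rewrite /lead_coef ws /= E => ->.
rewrite nth_default // ws ltn_double ltn_neqAle ne /=.
by have := msize_mdeg_lt mp; case: (msize p).
Qed.

(** A common factor [g] restricts to a polynomial without roots, a constant. The restriction of [p]
    has exactly twice its degree and that of [p'] at most twice, so [g] has degree 0. *)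
Lemma curve_coprime p q : nonneg_mpoly p -> p != 0 ->
  (forall z, root (curve p) z -> ~~ root (curve q) z) -> mcoprime p q.
Proof.
move=> hp p0 nocommon g p' q' Ep Eq.
have g0 : g != 0 by apply: contraNneq p0 => g0; rewrite Ep g0 mul0r.
have p'0 : p' != 0 by apply: contraNneq p0 => p'0; rewrite Ep p'0 mulr0.
have cp0 : curve p != 0 by rewrite -size_poly_eq0 size_curve.
have [cg0 cp'0] : curve g != 0 /\ curve p' != 0.
  by apply/andP; rewrite -negb_or -mulf_eq0 -curveM -Ep.
have no_root z : ~~ root (curve g) z.
  apply/negP => rg; have := nocommon z.
  by rewrite Ep Eq !curveM !rootM rg /= => /(_ isT).
have sg : size (curve g) = 1%N.
  apply/eqP; apply/negPn/negP => /closed_rootP[z rz].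
  by case/negP: (no_root z).
have sp : size (curve p) = (size (curve g) + size (curve p')).-1.
  by rewrite Ep curveM size_mul.
have := size_curve_le p'; have := msizeM g0 p'0; rewrite -Ep.
move: sp; rewrite size_curve // sg add1n /= => <-.
have := msize_poly_eq0 g; have := msize_poly_eq0 p'; rewrite (negPf g0) (negPf p'0).
move=> s1 s2 E le; have : msize g = 1%N.
  by move: E le; case: (msize g) s2 => // a; case: (msize p') s1 => // b _ _ -> /=; lia.
move/eqP/msize_poly1P => [c c0 ->]; apply/unitrP; exists (c^-1)%:MP.
by rewrite -!mpolyCM mulVf // mulfV.
Qed.

Lemma curve_monomial_root (al : 'I_d -> nat) z :
  root (curve (\prod_i 'X_i ^+ al i)) z -> exists2 i, (0 < al i)%N & z = i%:R.
Proof.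
rewrite rootE curveE rmorph_prod prodf_seq_eq0 => /hasP[i _ /=].
rewrite rmorphXn /= mevalXU -exprM expf_eq0 subr_eq0 muln_gt0.
by case/andP => al0 /eqP zi; exists i.
Qed.

Lemma curve_family_root r (f : 'I_r -> {mpoly C[d]}) (e : 'I_r -> nat) z :
  root (curve (\prod_k f k ^+ e k)) z -> exists2 k, (0 < e k)%N & root (curve (f k)) z.
Proof.
rewrite rootE curveE rmorph_prod prodf_seq_eq0 => /hasP[k _ /=].
rewrite rmorphXn /= expf_eq0 => /andP[e0 fk].
by exists k => //; rewrite rootE curveE.
Qed.

(** On the curve ['X_i] vanishes only at the parameter [i]; the roots of the [f k] avoid these
    parameters and each other, so disjoint exponents leave no common root. *)
Lemma monomial_family_coprime r (f : 'I_r -> {mpoly C[d]}) (al be : 'I_d -> nat)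
    (e e' : 'I_r -> nat) :
    (forall k, nonneg_mpoly (f k)) -> (forall k, f k != 0) ->
    (forall k l z, k != l -> root (curve (f k)) z -> ~~ root (curve (f l)) z) ->
    (forall k (i : 'I_d), ~~ root (curve (f k)) i%:R) ->
    (forall i, al i = 0%N \/ be i = 0%N) -> (forall k, e k = 0%N \/ e' k = 0%N) ->
  mcoprime ((\prod_i 'X_i ^+ al i) * \prod_k f k ^+ e k)
           ((\prod_i 'X_i ^+ be i) * \prod_k f k ^+ e' k).
Proof.
move=> hf f0 nofk nofX disj disj'.
apply: curve_coprime.
- apply: nonneg_mpolyM.
    by elim/big_ind: _ => [|p q|i _]; [exact: nonneg_mpoly1 | exact: nonneg_mpolyM |];
      rewrite mpolyXn; exact: nonneg_mpolyX.
  elim/big_ind: _ => [|p q|k _]; [exact: nonneg_mpoly1 | exact: nonneg_mpolyM |].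
  by elim: (e k) => [|x IH]; [exact: nonneg_mpoly1 | rewrite exprS; exact: nonneg_mpolyM].
- rewrite mulf_neq0 //; apply/prodf_neq0 => ? _; rewrite expf_neq0 //.
  by rewrite -msize_poly_eq0 msizeX.
- move=> z; rewrite !curveM !rootM negb_or => /orP[/curve_monomial_root|/curve_family_root].
    move=> [i ali ->]; apply/andP; split.
      apply/negP => /curve_monomial_root[i' bei' /eqP]; rewrite eqr_nat => /eqP/val_inj E.
      by case: (disj i) => E'; [rewrite E' in ali | rewrite -E E' in bei'].
    by apply/negP => /curve_family_root[k _]; apply/negP.
  move=> [k ek rk]; apply/andP; split.
    by apply/negP => /curve_monomial_root[i _ E]; move: rk; rewrite E; apply/negP.
  apply/negP => /curve_family_root[l el rl].
  have [E|/nofk/(_ rk)] := eqVneq k l; last by rewrite rl.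
  by case: (disj' k) => E'; [rewrite E' in ek | rewrite -E E' in el].
Qed.

(** * Generic coefficients *)

Section Coefficients.
Variables (r N : nat) (mu : 'I_r -> 'I_N -> 'X_{1..d}) (i0 : 'I_N).
Hypothesis mu0 : forall k (j : 'I_d), exists i, mu k i j = 0%N.

(** One adjustable coefficient per polynomial, at the vertex [i0], is enough to move its roots on
    the curve. *)
Definition vertex_coef (c : 'I_r -> nat) k i : C := if i == i0 then (c k)%:R else 1.

Definition vertex_poly c k : {mpoly C[d]} := \sum_i vertex_coef c k i *: 'X_[mu k i].

Lemma vertex_coef_gt0 c k i : (0 < c k)%N -> 0 < vertex_coef c k i.
Proof. by rewrite /vertex_coef; case: eqP => _ //; rewrite ltr0n. Qed.

Lemma nonneg_vertex_poly c k : (0 < c k)%N -> nonneg_mpoly (vertex_poly c k).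
Proof.
move=> ck; apply: nonneg_mpoly_sum => i _; apply: nonneg_mpolyZ.
  exact/ltW/vertex_coef_gt0.
exact: nonneg_mpolyX.
Qed.

Lemma vertex_poly_gt0 c k i : (0 < c k)%N -> 0 < (vertex_poly c k)@_(mu k i).
Proof.
move=> ck; rewrite /vertex_poly raddf_sum (bigD1 i) //= ltr_pwDl //.
  by rewrite mcoeffZ mcoeffX eqxx mulr1 vertex_coef_gt0.
rewrite sumr_ge0 // => l _; rewrite mcoeffZ mcoeffX mulr_ge0 ?ler0n //.
exact/ltW/vertex_coef_gt0.
Qed.

Lemma vertex_poly_neq0 c k : (0 < c k)%N -> vertex_poly c k != 0.
Proof.
move=> ck; apply: contraTneq (vertex_poly_gt0 i0 ck) => ->.
by rewrite mcoeff0 ltxx.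
Qed.

(** At the parameter [j] the coordinate [j] is zero and the others are positive, so a monomial free
    of ['X_j] makes the value positive. *)
Lemma curve_vertex_poly c k (j : 'I_d) : (0 < c k)%N -> ~~ root (curve (vertex_poly c k)) j%:R.
Proof.
move=> ck; rewrite rootE curveE; apply: lt0r_neq0.
have [i mui] := mu0 k j; have sq0 (x y : nat) : 0 <= (x%:R - y%:R : C) ^+ 2.
  have : (x%:R - y%:R : C) \is Num.real by rewrite realB // realn.
  by move/real_exprn_even_ge0; apply.
rewrite /vertex_poly raddf_sum (bigD1 i) //= ltr_pwDl //.
  rewrite mevalZ mulr_gt0 ?vertex_coef_gt0 // mevalX prodr_gt0 // => l _.
  have [->|ne] := eqVneq l j; first by rewrite mui.
  by rewrite exprn_gt0 // lt0r sq0 expf_neq0 // subr_eq0 eqr_nat eq_sym.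
rewrite sumr_ge0 // => l _; rewrite mevalZ mulr_ge0 //; first exact/ltW/vertex_coef_gt0.
by rewrite mevalX prodr_ge0 // => x _; rewrite exprn_ge0.
Qed.

Lemma nat_avoid (s : seq C) : exists2 c, (0 < c)%N & c%:R \notin s.
Proof.
apply: contrapT => none.
have : uniq [seq c%:R : C | c <- iota 1 (size s).+1].
  by rewrite map_inj_uniq ?iota_uniq //; exact: mulrIn (oner_neq0 _).
move/uniq_leq_size => /(_ s); rewrite size_map size_iota ltnn => H.
apply: notF; apply: H => x /mapP[c].
rewrite mem_iota => /andP[c0 _] ->.
by apply/negPn/negP => cs; apply: none; exists c.
Qed.

(** The coefficients are chosen one polynomial at a time, each avoiding finitely many values. *)
Lemma coprime_coefficients : exists c : 'I_r -> nat, (forall k, (0 < c k)%N) /\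
  forall k l z, k != l -> root (curve (vertex_poly c k)) z ->
    ~~ root (curve (vertex_poly c l)) z.
Proof.
suff H s : exists c : 'I_r -> nat, (forall k, (0 < c k)%N) /\
    forall (k l : 'I_r) z, (k < s)%N -> (l < k)%N -> root (curve (vertex_poly c k)) z ->
      ~~ root (curve (vertex_poly c l)) z.
  have [c [c0 Hc]] := H r; exists c; split=> // k l z.
  case: (ltngtP l k) => [lk _|kl _ rk|/val_inj->]; last by rewrite eqxx.
    exact: Hc.
  by apply/negP => /(Hc _ _ _ (ltn_ord l) kl); rewrite rk.
elim: s => [|s [c [c0 Hc]]]; first by exists (fun=> 1%N).
have [rs|sr] := leqP r s.
  by exists c; split=> // k l z _; apply: Hc; apply: leq_trans rs.
pose K := Ordinal sr.
pose q := \prod_(l < r) curve (vertex_poly c l).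
have [zs qE] := closed_field_poly_normal q.
have cne0 l : curve (vertex_poly c l) != 0.
  rewrite -size_poly_eq0 size_curve //; first exact: nonneg_vertex_poly.
  exact: vertex_poly_neq0.
have q0 : q != 0 by apply/prodf_neq0.
have zsP l z : root (curve (vertex_poly c l)) z -> z \in zs.
  move=> rz; have : root q z by rewrite /q (bigD1 l) //= rootM rz.
  by rewrite qE rootZ ?lead_coef_eq0 // root_prod_XsubC.
pose rest : {mpoly C[d]} := \sum_(i | i != i0) 'X_[mu K i].
(* Vanishing of polynomial [K] at a root [z] in [zs] is a linear equation in its free coefficient.
   The factor of that coefficient is nonzero because [z] is none of the parameters where a
   coordinate vanishes. *)
pose bad := [seq - (curve rest).[z] / (curve 'X_[mu K i0]).[z] | z <- zs].
have [cK cK0 cKbad] := nat_avoid bad.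
pose c' k := if k == K then cK else c k.
have c'0 k : (0 < c' k)%N by rewrite /c'; case: eqP.
have c'E k : k != K -> vertex_poly c' k = vertex_poly c k.
  move=> kK; apply: eq_bigr => i _; rewrite /vertex_coef /c' (negPf kK) //.
exists c'; split=> // k l z ks lk.
have lK : l != K by apply: contraTneq lk => ->; rewrite -leqNgt.
rewrite (c'E l) //; have [kK|kK] := eqVneq k K; last first.
  rewrite c'E //; apply: Hc => //; move: ks; rewrite ltnS leq_eqVlt.
  by case/orP => // /eqP E; case/eqP: kK; exact: val_inj.
rewrite kK => rk; apply/negP => rl; case/negP: cKbad.
apply/mapP; exists z; first exact: zsP rl.
have Mz : (curve 'X_[mu K i0]).[z] != 0.
  rewrite curveE mevalX; apply/prodf_neq0 => i _; rewrite !expf_neq0 // subr_eq0.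
  by apply: contraTneq rl => ->; exact: curve_vertex_poly.
apply: (canRL (mulfK Mz)); apply/eqP; rewrite -addr_eq0.
move: rk; rewrite rootE !curveE /vertex_poly (bigD1 i0) //= mevalD mevalZ.
rewrite /vertex_coef eqxx /c' eqxx.
by rewrite (eq_bigr (fun i => 'X_[mu K i])) // => i /negPf->; exact: scale1r.
Qed.

End Coefficients.
End Curve.

Definition exponent d (m : 'X_{1..d}) : 'cV[int]_d := \col_i (m i)%:Z.

Lemma exponentD d (m k : 'X_{1..d}) : exponent (m + k)%MM = exponent m + exponent k.
Proof. by apply/colP => i; rewrite !mxE mnmDE PoszD. Qed.

Lemma exponent0 d : exponent (0%MM : 'X_{1..d}) = 0.
Proof. by apply/colP => i; rewrite !mxE mnm0E. Qed.

(** * Newton polytopes squeezed between vertices and facets *)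

Section Newton.
Variables (R : realType) (d n N : nat) (F : 'M[int]_(d, n)).
Variables (I : 'I_N -> pred 'I_n) (G : 'I_N -> 'M[int]_(d, n)) (a : 'cV[int]_n).
Hypothesis H : simplicial_fan R F I G a.
Implicit Types (p q : {mpoly R[i][d]}) (b : 'cV[int]_n) (Q : set 'cV[R]_d).

Lemma vertexD i b b' : vertex G i (b + b') = vertex G i b + vertex G i b'.
Proof. by rewrite /vertex mulmxDr opprD. Qed.

Lemma vertex0 i : vertex G i 0 = 0.
Proof. by rewrite /vertex mulmx0 oppr0. Qed.

(** A certificate multiplicative in [p] and additive in [b]; positive coefficients at the vertices
    are what survives in products. *)
Definition newton_fits p b :=
  [/\ nonneg_mpoly p, forall m, m \in msupp p -> forall j, 0 <= (b + F^T *m exponent m) j 0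
    & forall i, exists2 m, exponent m = vertex G i b & 0 < p@_m].

Lemma newton_fits1 : newton_fits 1 0.
Proof.
split=> [|m|i]; first exact: nonneg_mpoly1.
  by rewrite msupp1 inE => /eqP-> j; rewrite exponent0 mulmx0 addr0 mxE.
by exists 0%MM; rewrite ?exponent0 ?vertex0 // mcoeff1 eqxx ltr01.
Qed.

Lemma newton_fitsM p q b b' :
  newton_fits p b -> newton_fits q b' -> newton_fits (p * q) (b + b').
Proof.
move=> [p1 p2 p3] [q1 q2 q3]; split=> [|m|i]; first exact: nonneg_mpolyM.
  move/msuppM_le/allpairsP => [[m1 m2] /= [h1 h2 ->]] j.
  by rewrite exponentD mulmxDr addrACA mxE addr_ge0 ?p2 ?q2.
have [m Em pm] := p3 i; have [k Ek qk] := q3 i.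
exists (m + k)%MM; first by rewrite exponentD Em Ek vertexD.
exact: nonneg_mpolyM_gt0.
Qed.

Lemma newton_fits_exp p b k : newton_fits p b -> newton_fits (p ^+ k) (b *+ k).
Proof.
move=> pb; elim: k => [|k IH]; first exact: newton_fits1.
by rewrite exprS mulrS; exact: newton_fitsM.
Qed.

Lemma newton_fits_prod r (p : 'I_r -> {mpoly R[i][d]}) (b : 'I_r -> 'cV[int]_n) :
  (forall k, newton_fits (p k) (b k)) -> newton_fits (\prod_k p k) (\sum_k b k).
Proof.
move=> Hp; elim/big_rec2: _ => [|k x y _]; first exact: newton_fits1.
exact: newton_fitsM.
Qed.

Lemma newton_fitsX m : newton_fits 'X_[m] (- (F^T *m exponent m)).
Proof.
split=> [|k|i]; first exact: nonneg_mpolyX.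
  by rewrite msuppX inE => /eqP-> j; rewrite addNr mxE.
exists m; last by rewrite mcoeffX eqxx ltr01.
by rewrite /vertex mulmxN mulmxA (fan_inv H) mul1mx opprK.
Qed.

Definition spans_polytope Q b :=
  Q `<=` facet_polytope F b /\ forall i, Q (to_real R (vertex G i b)).

Lemma newton_spans p b : newton_fits p b -> spans_polytope (newton p) b.
Proof.
have realE (m : 'X_{1..d}) : \col_(i < d) (m i)%:R = to_real R (exponent m).
  by apply/colP => i; rewrite !mxE -pmulrn.
move=> [_ p2 p3]; split=> [x [k [c [v [c0 c1 pv ->]]]] j|i].
  set y := (b j 0)%:~R; rewrite dotv_sumr -[y]mul1r -c1 mulr_suml -big_split /= sumr_ge0 // => l _.
  rewrite /= dotvZr -mulrDr mulr_ge0 //; have [m mp <-] := pv l.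
  by rewrite realE dotv_col /y -intrD ler0z addrC; have := p2 m mp j; rewrite mxE.
have [m Em pm] := p3 i; exists 1%N, (fun=> 1), (fun=> to_real R (vertex G i b)).
split=> //; rewrite ?big_ord1 ?scale1r // => _.
by exists m; rewrite ?realE ?Em //= mcoeff_msupp gt_eqF.
Qed.

Lemma spans_minkowski Q Q' b b' : spans_polytope Q b -> spans_polytope Q' b' ->
  spans_polytope (minkowski Q Q') (b + b').
Proof.
move=> [s1 v1] [s2 v2]; split=> [_ [x Qx [y Qy <-]] j|i].
  by rewrite dotvDr [(b + b') j 0]mxE intrD addrACA addr_ge0 ?s1 ?s2.
exists (to_real R (vertex G i b)) => //; exists (to_real R (vertex G i b')) => //.
by rewrite vertexD /to_real map_mxD.
Qed.

Lemma spans_big r (Q : 'I_r -> set 'cV[R]_d) (b : 'I_r -> 'cV[int]_n) :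
  (forall k, spans_polytope (Q k) (b k)) ->
  spans_polytope (\big[@minkowski R d/[set 0]]_k Q k) (\sum_k b k).
Proof.
move=> HQ; elim/big_rec2: _ => [|k x y _ Hy]; last exact: spans_minkowski.
split=> [x -> j|i]; first by rewrite dotvC dotv0l mxE addr0.
by rewrite vertex0; apply/colP => x; rewrite !mxE.
Qed.

Lemma spans_normal_fan Q Q' b b' : ample F I G b -> ample F I G b' ->
  spans_polytope Q b -> spans_polytope Q' b' -> normal_fan Q = normal_fan Q'.
Proof.
by move=> hb hb' [? ?] [? ?]; rewrite (normal_fanE H hb) // (normal_fanE H hb').
Qed.

End Newton.

(** * The slice of the Cox quotient *)

Section MonomialAction.
Variable R : realType.
Local Notation C := R[i].

Lemma exprz_sum (K : fieldType) (x : K) (J : Type) (s : seq J) (e : J -> int) :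
  x != 0 -> \prod_(j <- s) x ^ e j = x ^ (\sum_(j <- s) e j).
Proof.
by move=> x0; elim/big_rec2: _ => [|j y z _ ->]; rewrite ?expr0z // expfzDr.
Qed.

Lemma monomial_torus p q (M : 'M[int]_(p, q)) (x : 'I_q -> C) :
  torus x -> torus (monomial_map M x).
Proof. by move=> tx i; apply/prodf_neq0 => j _; rewrite expfz_neq0 // tx. Qed.

Lemma monomial_mulmx p q s (M : 'M[int]_(p, q)) (M' : 'M_(q, s)) (x : 'I_s -> C) :
  torus x -> monomial_map (M *m M') x = monomial_map M (monomial_map M' x).
Proof.
move=> tx; apply: funext => i; rewrite /monomial_map.
under [RHS]eq_bigr => j _ do rewrite (big_morph (fun y : C => y ^ M i j)
  (fun y z => expfzMl y z (M i j)) (@exp1rz _ (M i j))).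
rewrite exchange_big; apply: eq_bigr => k _; rewrite mxE /=.
under [RHS]eq_bigr => j _ do rewrite exprz_exp mulrC.
by rewrite exprz_sum ?tx.
Qed.

Lemma monomialD p q (M M' : 'M[int]_(p, q)) (x : 'I_q -> C) i :
  torus x -> monomial_map (M + M') x i = monomial_map M x i * monomial_map M' x i.
Proof.
move=> tx; rewrite -big_split; apply: eq_bigr => j _.
by rewrite mxE expfzDr // tx.
Qed.

Lemma monomial0 p q (x : 'I_q -> C) : monomial_map (0 : 'M_(p, q)) x = fun=> 1.
Proof. by apply: funext => i; apply: big1 => j _; rewrite mxE expr0z. Qed.

Lemma monomial1 q (x : 'I_q -> C) : monomial_map 1%:M x = x.
Proof.
apply: funext => i; rewrite /monomial_map (bigD1 i) //= big1 ?mxE ?eqxx ?mulr1 //.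
by move=> j /negPf ne; rewrite mxE eq_sym ne.
Qed.

Lemma monomial_of1 p q (M : 'M[int]_(p, q)) : monomial_map M (fun=> 1 : C) = fun=> 1.
Proof. by apply: funext => i; apply: big1 => j _; rewrite exp1rz. Qed.

Lemma monomial_mul p q (M : 'M[int]_(p, q)) (x y : 'I_q -> C) i :
  monomial_map M (fun j => x j * y j) i = monomial_map M x i * monomial_map M y i.
Proof. by rewrite -big_split; apply: eq_bigr => j _; rewrite expfzMl. Qed.

Lemma monomialN p q (M : 'M[int]_(p, q)) (x : 'I_q -> C) i :
  monomial_map (- M) x i = (monomial_map M x i)^-1.
Proof.
rewrite /monomial_map -prodfV; apply: eq_bigr => j _.
by rewrite mxE invr_expz.
Qed.

End MonomialAction.

Section Slice.
Variables (R : realType) (d n N : nat) (F : 'M[int]_(d, n)).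
Variables (I : 'I_N -> pred 'I_n) (G : 'I_N -> 'M[int]_(d, n)) (a : 'cV[int]_n).
Hypothesis H : simplicial_fan R F I G a.
Variable S : set (set 'cV[R]_d).
Hypothesis SE : S = [set s | exists i (J : pred 'I_n), (forall j, J j -> I i j) /\ s = conic F J].
Variables (r : nat) (A : 'M[int]_(r, n)) (c : 'M[int]_(n, r)) (B : 'M[int]_(n, d)).
Hypothesis AcB : completes F A c B.
Hypothesis ampleA : forall k, ample F I G (row k A)^T.
Variable coef : 'I_r -> 'I_N -> R[i].
Hypothesis coef_gt0 : forall k i, 0 < coef k i.
Local Notation C := R[i].
Implicit Types (u g : 'I_n -> C) (t : 'I_d -> C).

Lemma cox_ZP u : ~ cox_Z S F u <-> exists i, forall j, ~~ I i j -> u j != 0.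
Proof.
split=> [|[i Hi] Zu].
  move=> /existsNP[p /not_implyP[[k [b [g [Hg ->]]]] /eqP]].
  rewrite rmorph_sum /= => nz.
  have [l] : exists l, (b l * g l).@[u] != 0.
    by apply: contrapT => none; case/eqP: nz; apply: big1 => l _; apply/eqP/negPn/negP => ?;
      apply: none; exists l.
  rewrite mevalM mulf_eq0 negb_or => /andP[_]; have [s Ss ->] := Hg l.
  move: Ss; rewrite SE => -[i [J [JI ->]]] gu; exists i => j Ij.
  move: gu; rewrite rmorph_prod /= => /prodf_neq0/(_ j); rewrite mevalXU; apply.
  apply/asboolP => sub; case/negP: Ij; apply: (fan_ray H).
  have [|lam [lam0 off E]] := sub (to_real R (col j F)); first by exists 1; rewrite ?scale1r /=.
  exists lam; split=> // x Ix; apply: off; apply: contra Ix; exact: JI.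
pose p : {mpoly C[n]} := \prod_(j < n | `[< ~ ray_of R (col j F) `<=` conic F (I i) >]) 'X_j.
have pu : p.@[u] != 0.
  rewrite rmorph_prod; apply/prodf_neq0 => j /asboolP nsub; rewrite /= mevalXU.
  apply: Hi; apply/negP => Ij; apply: nsub => _ [k k0 <-].
  exists (fun l => if l == j then k else 0); split.
  - by move=> l; case: ifP.
  - by move=> l; case: eqP => // ->; rewrite Ij.
  - rewrite (bigD1 j) //= eqxx big1 ?addr0 // => l /negPf->; exact: scale0r.
case/negP: pu; apply/eqP/Zu; exists 1%N, (fun=> 1), (fun=> p); split.
  by move=> _; exists (conic F (I i)) => //; rewrite SE; exists i, (I i).
by rewrite big_ord1 mul1r.
Qed.

(** Homogenization of a vertex: its facet distances are the exponents of its Cox monomial. For ample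
    rows they are nonnegative, so [absz] changes nothing. *)
Definition slack_mnm k i : 'X_{1..n} := [multinom absz (slack F G i (row k A)^T j 0%R) | j < n].

Definition cox_poly k : {mpoly C[n]} := \sum_i coef k i *: 'X_[slack_mnm k i].

Definition cox_val u k : C := (cox_poly k).@[u].

Lemma cox_valE u k : cox_val u k =
  \sum_i coef k i * \prod_j u j ^ slack F G i (row k A)^T j 0.
Proof.
rewrite /cox_val rmorph_sum; apply: eq_bigr => i _; rewrite /= mevalZ mevalX.
congr (_ * _); apply: eq_bigr => j _; rewrite mnmE exprnP.
by congr (_ ^ _); rewrite gez0_abs // (slack_ge0 H).
Qed.

(** For [r = 0] the class group is trivial and [a] principal, so all its slacks vanish, against
    ampleness. *)
Lemma completion_index i j : ~~ I i j -> exists k : 'I_r, True.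
Proof.
move=> Ij; case: (pickP 'I_r) => [k|none]; first by exists k.
have cA : c *m A = 0.
  by apply/matrixP => x y; rewrite !mxE big1 // => k; have := none k.
have := fan_ample H Ij; case: AcB => h _ _.
rewrite cA add0r in h.
have -> : a = F^T *m (a^T *m B)^T.
  by apply: trmx_inj; rewrite trmx_mul !trmxK -mulmxA h mulmx1.
by rewrite (slackF H) mxE ltxx.
Qed.

(** If [cox_poly k] is nonzero at [u], so is some vertex monomial, whose exponents off [I i] are
    positive. If there is no [k], every [I i] is full. *)
Lemma torus_cox_val u : torus (cox_val u) -> ~ cox_Z S F u.
Proof.
move=> Du; apply/cox_ZP.
case: (pickP 'I_r) => [k _|none]; last first.
  have [i _] := fan_cover H 0; exists i => j /completion_index[k _].
  by have := none k.
have := Du k; rewrite cox_valE => nz.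
have [i Hi] : exists i, \prod_j u j ^ slack F G i (row k A)^T j 0 != 0.
  apply: contrapT => none; case/eqP: nz; apply: big1 => i _; apply/eqP.
  rewrite mulf_eq0 gt_eqF //=; apply/negPn/negP => ?; by apply: none; exists i.
exists i => j Ij; move/prodf_neq0/(_ j isT): Hi; apply: contraNneq => ->.
by rewrite expfz_eq0 eqxx andbT gt_eqF // (ampleA k Ij).
Qed.

Lemma cox_val_gt0 u k : ~ cox_Z S F u -> nonneg_orthant u -> 0 < cox_val u k.
Proof.
move=> /cox_ZP[i Hi] u0; rewrite cox_valE (bigD1 i) //= ltr_pwDl //.
  rewrite mulr_gt0 // prodr_gt0 // => j _.
  have [Ij|Ij] := boolP (I i j); first by rewrite (slack_on H).
  by rewrite exprz_gt0 // lt0r Hi ?u0.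
rewrite sumr_ge0 // => l _; rewrite mulr_ge0 ?prodr_ge0 //; first exact: ltW.
by move=> j _; rewrite exprz_ge0.
Qed.

Lemma slack_monomial u k i : torus u ->
  \prod_j u j ^ slack F G i (row k A)^T j 0 =
  monomial_map A u k * \prod_x monomial_map F u x ^ vertex G i (row k A)^T x 0.
Proof.
move=> tu; transitivity (monomial_map (slack F G i (row k A)^T)^T u 0).
  by apply: eq_bigr => j _; congr (_ ^ _); rewrite [RHS]mxE.
rewrite slackE linearD /= trmx_mul !trmxK monomialD // monomial_mulmx //.
congr (_ * _); first by apply: eq_bigr => j _; rewrite mxE.
by apply: eq_bigr => x _; rewrite mxE.
Qed.

Lemma cox_val_torus u k : torus u -> cox_val u k = monomial_map A u k *
  \sum_i coef k i * \prod_x monomial_map F u x ^ vertex G i (row k A)^T x 0.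
Proof.
move=> tu; rewrite cox_valE mulr_sumr; apply: eq_bigr => i _.
by rewrite slack_monomial // mulrCA.
Qed.

Lemma cox_val_equivariant g u k : cox_group F g ->
  cox_val (fun j => g j * u j) k = monomial_map A g k * cox_val u k.
Proof.
move=> [tg Fg]; rewrite !cox_valE mulr_sumr; apply: eq_bigr => i _.
rewrite [RHS]mulrCA; congr (_ * _).
under eq_bigr => j _ do rewrite expfzMl.
rewrite big_split /= slack_monomial // Fg; congr (_ * _).
by rewrite big1 ?mulr1 // => x _; rewrite exp1rz.
Qed.

Lemma cox_group_torus g y : cox_group F g -> torus y ->
  torus (fun k : 'I_r => monomial_map A g k * y k).
Proof. by move=> [tg _] ty k; rewrite mulf_neq0 // monomial_torus. Qed.

(* The unique translate of u by cox_group on which all cox_poly k equal 1. *)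
Definition to_slice u : 'I_n -> C := fun j => u j * monomial_map (- c) (cox_val u) j.

Lemma slice_group u : torus (cox_val u) -> cox_group F (monomial_map (- c) (cox_val u)).
Proof.
move=> Du; split; first exact: monomial_torus.
by case: AcB => _ _ Fc; rewrite -monomial_mulmx // mulmxN Fc oppr0 monomial0.
Qed.

Definition slice : set ('I_n -> C) := [set u | cox_val u = fun=> 1].

Lemma slice_torus u : slice u -> torus (cox_val u).
Proof. by move=> -> k; exact: oner_neq0. Qed.

Lemma to_sliceE u : to_slice u = fun j => monomial_map (- c) (cox_val u) j * u j.
Proof. by apply: funext => j; rewrite mulrC. Qed.

Lemma to_sliceP u : torus (cox_val u) -> slice (to_slice u).
Proof.
move=> Du; apply: funext => k; rewrite to_sliceE cox_val_equivariant; last exact: slice_group.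
rewrite -monomial_mulmx //; case: AcB => _ Ac _.
by rewrite mulmxN Ac monomialN monomial1 mulVf.
Qed.

Lemma to_slice_id u : slice u -> to_slice u = u.
Proof. by move=> Uu; apply: funext => j; rewrite /to_slice Uu monomial_of1 mulr1. Qed.

(** An element [g] of the group is determined by the characters in [A]: since
    [c *m A = 1%:M - B *m F] and [F] sends [g] to 1, applying [c *m A] returns [g]. *)
Lemma to_slice_equivariant g u : cox_group F g -> torus (cox_val u) ->
  to_slice (fun j => g j * u j) = to_slice u.
Proof.
move=> Gg Du; apply: funext => j; rewrite /to_slice.
have -> : cox_val (fun j => g j * u j) = fun k => monomial_map A g k * cox_val u k.
  by apply: funext => k; rewrite cox_val_equivariant.
have [tg Fg] := Gg.
rewrite monomial_mul -monomial_mulmx // mulNmx.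
have -> : c *m A = 1%:M - B *m F by case: AcB => <- _ _; rewrite addrK.
rewrite opprB monomialD // monomial_mulmx // Fg monomial_of1 mul1r (monomialN 1%:M) monomial1.
by rewrite mulrA [g j * _]mulrC mulfK // tg.
Qed.

Lemma cox_group1 : cox_group F (fun=> 1 : C).
Proof. by split=> [i|]; [exact: oner_neq0 | exact: monomial_of1]. Qed.

Lemma cox_pi_refl u : cox_pi F u u.
Proof. by exists (fun=> 1); [exact: cox_group1 | apply: funext => j; rewrite mul1r]. Qed.

Lemma cox_pi_mul g u : cox_group F g -> cox_pi F (fun j => g j * u j) = cox_pi F u.
Proof.
move=> [tg Fg]; apply/seteqP; split=> _ [h [th Fh] <-].
  exists (fun j => h j * g j); last by apply: funext => j; rewrite mulrA.
  split=> [j|]; first by rewrite mulf_neq0 ?th ?tg.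
  by apply: funext => i; rewrite monomial_mul Fh Fg mulr1.
exists (fun j => h j * (g j)^-1); last first.
  by apply: funext => j; rewrite mulrA mulfVK // tg.
split=> [j|]; first by rewrite mulf_neq0 ?th // invr_eq0 tg.
apply: funext => i; rewrite monomial_mul Fh mul1r.
have -> : (fun j => (g j)^-1) = monomial_map (- 1%:M) g.
  by apply: funext => j; rewrite monomialN monomial1.
by rewrite -monomial_mulmx // mulmxN mulmx1 monomialN Fg invr1.
Qed.

Lemma cox_pi_slice u : torus (cox_val u) -> cox_pi F (to_slice u) = cox_pi F u.
Proof. by move=> Du; rewrite to_sliceE cox_pi_mul //; exact: slice_group. Qed.

Lemma cox_pi_torus u v : cox_pi F u = cox_pi F v -> torus (cox_val u) -> torus (cox_val v).
Proof.
move=> E Du; have : cox_pi F u v by rewrite E; exact: cox_pi_refl.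
move=> [g Gg <-] k; rewrite cox_val_equivariant //; exact: cox_group_torus.
Qed.

(** * The affine chart and its inverse *)

Definition chart : set (set ('I_n -> C)) := cox_pi F @` [set u | torus (cox_val u)].

(** Points of the quotient are orbits; on the chart the value does not depend on the representative
    picked by [xget]. *)
Definition chart_inv (o : set ('I_n -> C)) : 'I_n -> C := to_slice (xget (fun=> 0) o).

Lemma chart_invE u : torus (cox_val u) -> chart_inv (cox_pi F u) = to_slice u.
Proof.
move=> Du; rewrite /chart_inv.
have [g Gg <-] : cox_pi F u (xget (fun=> 0) (cox_pi F u)).
  by apply: xgetPex; exists u; exact: cox_pi_refl.
exact: to_slice_equivariant.
Qed.

Lemma chartP u : chart (cox_pi F u) <-> torus (cox_val u).
Proof.
split=> [[v Dv /cox_pi_torus]|Du]; last by exists u.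
exact.
Qed.

Definition cox_prod : {mpoly C[n]} := \prod_k cox_poly k.

Lemma cox_prod_neq0 u : torus (cox_val u) <-> cox_prod.@[u] != 0.
Proof.
rewrite rmorph_prod; split=> [Du|/prodf_neq0 Du k]; last exact: Du.
by apply/prodf_neq0 => k _; exact: Du.
Qed.

(** The components of [to_slice] have only powers of the [cox_poly k] as denominators. This carries
    closed sets and fractions on the slice back to polynomials upstairs. *)
Lemma clear_denominators (q : {mpoly C[n]}) : exists q' e, forall u, torus (cox_val u) ->
  q'.@[u] = cox_prod.@[u] ^+ e * q.@[to_slice u].
Proof.
elim/mpolyind: q => [|x m q _ _ [q' [e Hq]]].
  by exists 0, 0%N => u _; rewrite !meval0 mulr0.
have cleared0 (K : Type) (s : seq K) (f : K -> {mpoly C[n]}) :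
  (forall k, exists p' e, forall u, torus (cox_val u) ->
    p'.@[u] = cox_prod.@[u] ^+ e * (f k).@[to_slice u]) ->
  exists p' e, forall u, torus (cox_val u) ->
    p'.@[u] = cox_prod.@[u] ^+ e * (\prod_(k <- s) f k).@[to_slice u].
  move=> Hf; elim: s => [|k s [p' [e' IH]]].
    by exists 1, 0%N => u _; rewrite big_nil !meval1 mulr1.
  have [p2 [e2 H2]] := Hf k; exists (p2 * p'), (e2 + e')%N => u Du.
  by rewrite big_cons !mevalM IH // H2 // exprD mulrACA.
have [m' [e' Hm]] : exists p' e, forall u, torus (cox_val u) ->
    p'.@[u] = cox_prod.@[u] ^+ e * ('X_[m] : {mpoly C[n]}).@[to_slice u].
  rewrite mpolyXE_id; apply: (@cleared0 _ _ _) => j.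
  rewrite -[m j]card_ord -prodr_const; apply: (@cleared0 _ _ _) => _ {m}.
  (* [e0] bounds every [c j k], so the exponents [e0 - c j k] are nonnegative. *)
  pose e0 := (\sum_k absz (c j k))%N.
  have le k : c j k <= e0%:Z.
    by rewrite (le_trans (ler_norm _)) // -abszE lez_nat /e0 (bigD1 k) //= leq_addr.
  exists ('X_j * \prod_k cox_poly k ^+ absz (e0%:Z - c j k)), e0 => u Du.
  rewrite mevalM !mevalXU /to_slice mulrCA; congr (_ * _).
  rewrite /cox_prod !rmorph_prod -prodrXl -big_split; apply: eq_bigr => k _ /=.
  rewrite rmorphXn /= exprnP gez0_abs ?subr_ge0 // expfzDr; last exact: Du.
  by rewrite mxE exprnP.
exists (x *: m' * cox_prod ^+ e + q' * cox_prod ^+ e'), (e' + e)%N => u Du.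
rewrite !mevalD !mevalM !mevalZ !rmorphXn /= Hm // Hq // exprD; ring.
Qed.

Lemma open_slice_preimage W : zariski_closed (~` W) ->
  zariski_closed (~` [set u | torus (cox_val u) /\ W (to_slice u)]).
Proof.
(* The extra factor [cox_prod] puts all points outside the chart into the closed set. *)
move=> [Z WZ]; exists [set p | exists q q' e, [/\ Z q, forall u, torus (cox_val u) ->
  q'.@[u] = cox_prod.@[u] ^+ e * q.@[to_slice u] & p = cox_prod * q']].
have WE x : W x <-> ~ zero_locus Z x.
  by rewrite -WZ; split=> [Wx nW|/contrapT]; first exact: nW.
apply/seteqP; split=> u /=.
  move=> nDW p [q [q' [e [Zq Eq ->]]]]; rewrite mevalM.
  have [->|/cox_prod_neq0 Du] := eqVneq cox_prod.@[u] 0; first by rewrite mul0r.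
  rewrite Eq // [q.@[_]](_ : _ = 0) ?mulr0 //.
  have /(_ q Zq) // : zero_locus Z (to_slice u).
  by rewrite -WZ => Ws; apply: nDW.
move=> Hu [Du /WE]; apply => q Zq.
have [q' [e Eq]] := clear_denominators q.
have /eqP : (cox_prod * q').@[u] = 0 by apply: Hu; exists q, q', e.
have /negPf Q0 := (cox_prod_neq0 u).1 Du.
by rewrite mevalM Eq // !mulf_eq0 expf_eq0 Q0 andbF /= => /eqP.
Qed.

Lemma open_setI (V W : set ('I_n -> C)) :
  zariski_closed (~` V) -> zariski_closed (~` W) -> zariski_closed (~` (V `&` W)).
Proof.
move=> [Z1 E1] [Z2 E2]; exists [set p | exists2 q1, Z1 q1 & exists2 q2, Z2 q2 & p = q1 * q2].
rewrite setCI E1 E2; apply/seteqP; split=> u /=.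
  move=> h p [q1 h1 [q2 h2 ->]]; rewrite mevalM.
  by case: h => Hu; [rewrite (Hu _ h1) mul0r | rewrite (Hu _ h2) mulr0].
move=> Hu; apply: contrapT => /not_orP[].
move=> /existsNP[q1 /not_implyP[h1 /eqP n1]] /existsNP[q2 /not_implyP[h2 /eqP n2]].
have /eqP : (q1 * q2).@[u] = 0 by apply: Hu; exists q1 => //; exists q2.
by rewrite mevalM mulf_eq0 (negPf n1) (negPf n2).
Qed.

Lemma open_nonzero (q : {mpoly C[n]}) : zariski_closed (~` [set u | q.@[u] != 0]).
Proof.
exists [set q]; apply/seteqP; split=> u /=.
  by move=> /negP/negPn/eqP qu p ->.
by move=> /(_ q erefl) ->; rewrite eqxx.
Qed.

Lemma open_setT : zariski_closed (~` [set: 'I_n -> C]).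
Proof.
exists [set 1]; rewrite setCT; apply/seteqP; split=> u //= /(_ 1 erefl)/eqP.
by rewrite meval1 oner_eq0.
Qed.

Local Notation X := (toric_variety S F).

Lemma open_chart_preimage W : zariski_closed (~` W) ->
  is_open X (chart `&` chart_inv @^-1` W).
Proof.
move=> oW; split=> [o [[u Du <-] _]|]; first by exists u => //; exact: torus_cox_val.
exists [set u | torus (cox_val u) /\ W (to_slice u)]; first exact: open_slice_preimage.
apply/seteqP; split=> u /= [nZ].
  by move=> [/chartP Du]; rewrite chart_invE.
by move=> [Du Wu]; split=> //; split; [exact/chartP | rewrite /= chart_invE].
Qed.

Lemma open_chart : is_open X chart.
Proof. by have := open_chart_preimage open_setT; rewrite preimage_setT setIT. Qed.

Lemma slice_sub_chart u : slice u -> chart (cox_pi F u).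
Proof. by move=> Uu; apply/chartP; exact: slice_torus. Qed.

Lemma morphism_to_chart :
  morphism (subspace (affine_space R n) slice) (subspace X chart) (cox_pi F).
Proof.
split=> [u|V [V1 [_ [V0 oV0 EV]] ->]|V g _ rg u [Uu Vu]]; first exact: slice_sub_chart.
  exists V0 => //; apply/seteqP; split=> u /= [Uu].
    move=> [_ V1u]; split=> //.
    suff [] : (points (subspace (affine_space R n) (~` cox_Z S F)) `&` V0) u by [].
    rewrite -EV; split=> //; exact/torus_cox_val/slice_torus.
  move=> V0u; split=> //; split; first exact: slice_sub_chart.
  suff [] : (points (subspace (affine_space R n) (~` cox_Z S F)) `&` cox_pi F @^-1` V1) u by [].
  rewrite [X in X u]EV; split=> //; exact/torus_cox_val/slice_torus.
have [V1 [g1 [[_ [V0 oV0 EV]] V1u rg1 Eg]]] := rg _ Vu.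
have nZ v : slice v -> ~ cox_Z S F v by move=> ?; exact/torus_cox_val/slice_torus.
have V0V1 v : slice v -> V0 v -> V1 (cox_pi F v).
  move=> Uv V0v.
  suff [] : (points (subspace (affine_space R n) (~` cox_Z S F)) `&` cox_pi F @^-1` V1) v by [].
  by rewrite [X in X v]EV; split=> //; exact: nZ.
have V0u : V0 u.
  suff [] : (points (subspace (affine_space R n) (~` cox_Z S F)) `&` V0) u by [].
  by rewrite -EV; split=> //; exact: nZ.
have [|V2 [g2 [oV2 V2u rg2 Eg2]]] := rg1 u; first by split=> //; exact: nZ.
exists (V2 `&` V0), g2; split=> //; first exact: open_setI.
  by move=> x [V2x _]; have [p [q [q0 E]]] := rg2 x V2x; exists p, q; split=> // y [? _]; exact: E.
move=> v [Uv Vv] [V2v V0v]; rewrite /= Eg //; last exact: V0V1.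
by apply: (Eg2 v) => //; split; [exact: nZ | exact: V0V1].
Qed.

Lemma morphism_to_slice :
  morphism (subspace X chart) (subspace (affine_space R n) slice) chart_inv.
Proof.
have inv_slice o : chart o -> slice (chart_inv o).
  by move=> [u Du <-]; rewrite chart_invE //; exact: to_sliceP.
split=> [|V [W oW ->]|V f _ rf o [co Vo]]; first exact: inv_slice.
  exists (chart `&` chart_inv @^-1` W); first exact: open_chart_preimage.
  apply/seteqP; split=> o /= [co]; first by move=> [_ Wo].
  by move=> [_ Wo]; split=> //; split=> //; exact: inv_slice.
have [V2 [f2 [oV2 V2o rf2 Ef]]] := rf _ Vo.
exists (chart `&` chart_inv @^-1` V2), (f2 \o chart_inv); split.
- exact: open_chart_preimage.
- by split.
- move=> u [nZ [/chartP Du]]; rewrite /= chart_invE // => V2u.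
  have [p [q [q0 E]]] := rf2 _ V2u.
  have [p' [e Ep]] := clear_denominators p; have [q' [e' Eq]] := clear_denominators q.
  pose W := V2 `&` [set y | q.@[y] != 0].
  exists [set y | torus (cox_val y) /\ W (to_slice y)], (fun y => p.@[to_slice y] / q.@[to_slice y]).
  split.
  + by apply: open_slice_preimage; apply: open_setI => //; exact: open_nonzero.
  + by split.
  + have den y : torus (cox_val y) -> q.@[to_slice y] != 0 -> (q' * cox_prod ^+ e).@[y] != 0.
      move=> Dy qy; rewrite mevalM rmorphXn /= Eq // !mulf_neq0 ?expf_neq0 //; exact/cox_prod_neq0.
    (* [p'] and [q'] carry the powers [e] and [e'] of [cox_prod]; exchanging these powers cancels
       them in the fraction. *)
    move=> y [Dy [_ qy]]; exists (p' * cox_prod ^+ e'), (q' * cox_prod ^+ e).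
    split; first exact: den.
    move=> z [Dz [_ qz]] _; rewrite !mevalM !rmorphXn /= Ep // Eq //.
    have Q0 := (cox_prod_neq0 z).1 Dz.
    have := expf_neq0 e Q0; have := expf_neq0 e' Q0.
    move: (_ ^+ e') (_ ^+ e) => x1 x2 n1 n2; field; exact/and3P.
  + move=> y [_ [/chartP Dy _]] [_ [V2y qy]]; rewrite /= chart_invE // E //.
- by move=> o' [co' Vo'] [_ V2o']; exact: Ef.
Qed.

Lemma cox_pi_chart_inv o : chart o -> cox_pi F (chart_inv o) = o.
Proof. by move=> [u Du <-]; rewrite chart_invE // cox_pi_slice. Qed.

Lemma chart_inv_cox_pi u : slice u -> chart_inv (cox_pi F u) = u.
Proof. by move=> Uu; rewrite chart_invE ?to_slice_id //; exact: slice_torus. Qed.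

Lemma slice_isomorphism :
  isomorphism (subspace (affine_space R n) slice) (subspace X chart) (cox_pi F).
Proof.
split; first exact: morphism_to_chart.
exists chart_inv; split; first exact: morphism_to_slice.
  exact: chart_inv_cox_pi.
exact: cox_pi_chart_inv.
Qed.

Lemma slice_nonempty : slice !=set0.
Proof.
exists (to_slice (fun=> 1)); apply: to_sliceP => k; apply: lt0r_neq0.
apply: cox_val_gt0; last by move=> j; exact: ler01.
apply/cox_ZP; have [i _] := fan_cover H 0; exists i => j _; exact: oner_neq0.
Qed.

(* The slice is the image under to_slice of an open subset of affine space, so
   irreducibility reduces to that of a line through two preimages. *)
Lemma slice_affine_variety : affine_variety slice.
Proof.
split.
  exists (range (fun k => cox_poly k - 1)); apply/seteqP; split=> u /=.
    move=> Uu _ [k _ <-]; rewrite mevalB meval1; have := congr1 (@^~ k) Uu.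
    by rewrite /cox_val => ->; rewrite subrr.
  move=> Hu; apply: funext => k; apply/eqP; rewrite -subr_eq0; apply/eqP.
  by have := Hu (cox_poly k - 1); rewrite mevalB meval1; apply; exists k.
split; first exact: slice_nonempty.
move=> _ _ [Z1 ->] [Z2 ->] cover; apply: contrapT => /not_orP[].
move=> /existsNP[u1 /not_implyP[U1 /existsNP[p1 /not_implyP[Zp1 /eqP np1]]]].
move=> /existsNP[u2 /not_implyP[U2 /existsNP[p2 /not_implyP[Zp2 /eqP np2]]]].
have [q1 [e1 E1]] := clear_denominators p1; have [q2 [e2 E2]] := clear_denominators p2.
pose line (q : {mpoly C[n]}) : {poly C} :=
  mmap (@polyC C) (fun j => (u1 j)%:P + 'X * (u2 j - u1 j)%:P) q.
have lineE q z : (line q).[z] = q.@[fun j => u1 j + z * (u2 j - u1 j)].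
  rewrite /line /mmap horner_sum mevalE; apply: eq_bigr => m _.
  rewrite hornerCM /mmap1 horner_prod; congr (_ * _); apply: eq_bigr => j _.
  by rewrite horner_exp !hornerE.
have line0 q : (line q).[0] = q.@[u1].
  by rewrite lineE; apply: meval_eq => j; rewrite mul0r addr0.
have line1 q : (line q).[1] = q.@[u2].
  by rewrite lineE; apply: meval_eq => j; rewrite mul1r addrC subrK.
have n0 (q : {poly C}) z : q.[z] != 0 -> q != 0.
  by apply: contraNneq => ->; rewrite horner0.
have D1 := slice_torus U1; have D2 := slice_torus U2.
have nz1 : q1.@[u1] != 0.
  by rewrite E1 // to_slice_id // mulf_neq0 // expf_neq0 //; exact/cox_prod_neq0.
have nz2 : q2.@[u2] != 0.
  by rewrite E2 // to_slice_id // mulf_neq0 // expf_neq0 //; exact/cox_prod_neq0.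
have : line cox_prod * (line q1 * line q2) != 0.
  rewrite !mulf_neq0 //; first by apply: (n0 _ 0); rewrite line0; exact/cox_prod_neq0.
    by apply: (n0 _ 0); rewrite line0.
  by apply: (n0 _ 1); rewrite line1.
move=> /closed_nonrootP[z]; rewrite !rootM !negb_or !rootE !lineE.
set u := fun j => _; move=> /andP[/cox_prod_neq0 Du]; rewrite E1 // E2 //.
have Q0 := (cox_prod_neq0 u).1 Du.
rewrite !mulf_eq0 !negb_or => /andP[/andP[_ s1] /andP[_ s2]].
case: (cover _ (to_sliceP Du)) => [/(_ _ Zp1)/eqP|/(_ _ Zp2)/eqP]; exact/negP.
Qed.

Lemma chart_affine : is_affine (subspace X chart).
Proof.
exists n, slice, chart_inv; split; first exact: slice_affine_variety.
split; first exact: morphism_to_slice.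
exists (cox_pi F); split; first exact: morphism_to_chart.
  exact: cox_pi_chart_inv.
exact: chart_inv_cox_pi.
Qed.

(** On nonnegative points outside Z the [cox_val] are positive, so the group element moving such a
    point to the slice preserves nonnegativity. *)
Lemma slice_nonneg :
  cox_pi F @` (slice `&` @nonneg_orthant R n) = toric_nonneg S F.
Proof.
apply/seteqP; split=> [_ [u [Uu u0] <-]|_ [_ [u [nZ <- u0]]]].
  have nZ := torus_cox_val (slice_torus Uu).
  by split; [exists u | exists u].
have P0 k := cox_val_gt0 k nZ u0.
have Du : torus (cox_val u) by move=> k; apply: lt0r_neq0.
exists (to_slice u); last exact: cox_pi_slice.
split; first exact: to_sliceP.
move=> j; rewrite mulr_ge0 // prodr_ge0 // => k _; rewrite exprz_ge0 //; exact: ltW.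
Qed.

End Slice.

(** * The rational parametrization *)

Definition pos_part (z : int) : nat := if z is Posz k then k else 0%N.

Lemma pos_part_disjoint z : pos_part z = 0%N \/ pos_part (- z) = 0%N.
Proof. by case: z => [[|k]|k]; [left | right | left]. Qed.

Lemma exprz_pos_part (K : fieldType) (x : K) z : x ^ z = x ^+ pos_part z / x ^+ pos_part (- z).
Proof.
by case: z => [[|k]|k]; rewrite /= ?expr0z ?expr0 ?divr1 // mul1r.
Qed.

Lemma pos_part_gt0 z : z != 0 -> (0 < pos_part z + pos_part (- z))%N.
Proof. by case: z => [[|k]|k]. Qed.

Section Parametrization.
Variables (R : realType) (d n r : nat) (f : 'I_r -> {mpoly R[i][d]}).
Variables (E : 'M[int]_(n, d)) (c : 'M[int]_(n, r)).
Local Notation C := R[i].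

(** Only positive exponents are kept; negating both matrices gives the denominator of the same
    Laurent expression. *)
Definition laurent_numer (E' : 'M[int]_(n, d)) (c' : 'M[int]_(n, r)) j : {mpoly C[d]} :=
  (\prod_i 'X_i ^+ pos_part (E' j i)) * \prod_k f k ^+ pos_part (c' j k).

Lemma laurent_numer_neq0 E' c' j : (forall k, f k != 0) -> laurent_numer E' c' j != 0.
Proof.
move=> f0; rewrite mulf_neq0 //; apply/prodf_neq0 => ? _; rewrite expf_neq0 //.
by rewrite -msize_poly_eq0 msizeX.
Qed.

Lemma laurent_eval j t : torus t -> (forall k, (f k).@[t] != 0) ->
  (laurent_numer (- E) (- c) j).@[t] != 0 /\
  (laurent_numer E c j).@[t] / (laurent_numer (- E) (- c) j).@[t] =
  monomial_map E t j * monomial_map c (fun k => (f k).@[t]) j.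
Proof.
move=> tt ft; rewrite /laurent_numer !mevalM !rmorph_prod /=.
have X1 (e : 'I_d -> nat) : \prod_i ('X_i ^+ e i : {mpoly C[d]}).@[t] = \prod_i t i ^+ e i.
  by apply: eq_bigr => i _; rewrite rmorphXn /= mevalXU.
have X2 (e : 'I_r -> nat) : \prod_k (f k ^+ e k).@[t] = \prod_k (f k).@[t] ^+ e k.
  by apply: eq_bigr => k _; rewrite rmorphXn.
rewrite !X1 !X2; split.
  by rewrite mulf_neq0 //; apply/prodf_neq0 => ? _; rewrite expf_neq0.
rewrite invfM mulrACA -!prodfV -!big_split /=; congr (_ * _); apply: eq_bigr => ? _;
  by rewrite [RHS]exprz_pos_part !mxE.
Qed.

End Parametrization.

(** * The inverse of the quotient map on the torus *)

Section SliceParametrization.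
Variables (R : realType) (d n N : nat) (F : 'M[int]_(d, n)).
Variables (I : 'I_N -> pred 'I_n) (G : 'I_N -> 'M[int]_(d, n)) (a : 'cV[int]_n).
Hypothesis H : simplicial_fan R F I G a.
Variables (r : nat) (A : 'M[int]_(r, n)) (c : 'M[int]_(n, r)) (B : 'M[int]_(n, d)).
Hypothesis AcB : completes F A c B.
Hypothesis ampleA : forall k, ample F I G (row k A)^T.
Local Notation C := R[i].

(** The translation by [v] turns each Laurent dehomogenization into a polynomial divisible by no
    variable. *)
Lemma vertex_min : exists v : 'M[int]_(r, d), forall k x,
  (forall i, v k x <= vertex G i (row k A)^T x 0) /\ exists i, vertex G i (row k A)^T x 0 = v k x.
Proof.
have [i0 _] := fan_cover H 0.
have /choice[v Hv] : forall kx : 'I_r * 'I_d, exists v : int,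
    (forall i, v <= vertex G i (row kx.1 A)^T kx.2 0) /\
    exists i, vertex G i (row kx.1 A)^T kx.2 0 = v.
  move=> [k x]; have i0e : i0 \in enum 'I_N by rewrite mem_enum.
  have [i _ Hi] := seq_argmin (fun i => vertex G i (row k A)^T x 0) i0e.
  exists (vertex G i (row k A)^T x 0); split=> [i'|]; last by exists i.
  by apply: Hi; rewrite mem_enum.
exists (\matrix_(k, x) v (k, x)) => k x; rewrite mxE; exact: (Hv (k, x)).
Qed.

Variable vmin : 'M[int]_(r, d).
Hypothesis vminP : forall k x, (forall i, vmin k x <= vertex G i (row k A)^T x 0) /\
  exists i, vertex G i (row k A)^T x 0 = vmin k x.

Definition vertex_mnm k i : 'X_{1..d} :=
  [multinom absz (vertex G i (row k A)^T x 0%R - vmin k x) | x < d].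

Lemma exponent_vertex_mnm k i :
  exponent (vertex_mnm k i) = vertex G i (row k A)^T - (row k vmin)^T.
Proof.
apply/colP => x; rewrite mxE mnmE gez0_abs ?subr_ge0; last by case: (vminP k x).
by rewrite [RHS]mxE; congr (_ + _); rewrite !mxE.
Qed.

Lemma vertex_mnm0 k (x : 'I_d) : exists i, vertex_mnm k i x = 0%N.
Proof.
by have [_ [i E]] := vminP k x; exists i; rewrite mnmE E subrr.
Qed.

Variables (i0 : 'I_N) (cf : 'I_r -> nat).
Hypothesis cf0 : forall k, (0 < cf k)%N.
Hypothesis cf_coprime : forall k l z, k != l ->
  root (curve (vertex_poly R vertex_mnm i0 cf k) : {poly C}) z ->
  ~~ root (curve (vertex_poly R vertex_mnm i0 cf l) : {poly C}) z.

Let f k : {mpoly C[d]} := vertex_poly R vertex_mnm i0 cf k.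
Let coef : 'I_r -> 'I_N -> C := vertex_coef R i0 cf.
(** Exponents of the monomial factors: [B] recovers [u] from its image in the torus, and
    [- c *m vmin] accounts for the monomials split off from the dehomogenizations. *)
Let E : 'M[int]_(n, d) := B - c *m vmin.

Lemma cox_val_vertex_poly u k : torus u -> cox_val F G A coef u k =
  monomial_map A u k * (monomial_map vmin (monomial_map F u) k * (f k).@[monomial_map F u]).
Proof.
move=> tu; rewrite (cox_val_torus H) //; congr (_ * _).
rewrite /f /vertex_poly rmorph_sum mulr_sumr; apply: eq_bigr => i _.
rewrite /= mevalZ mulrCA; congr (_ * _); rewrite mevalX -big_split; apply: eq_bigr => x _.
rewrite /= mnmE exprnP gez0_abs ?subr_ge0; last by case: (vminP k x).
by rewrite -expfzDr ?subrKC //; exact: monomial_torus.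
Qed.

Let f0 k : f k != 0.
Proof. by have := vertex_poly_neq0 R vertex_mnm i0 (cf0 k). Qed.

Lemma parametrization_coprime j :
  mcoprime (laurent_numer f E (- c) j) (laurent_numer f (- E) (- - c) j).
Proof.
apply: monomial_family_coprime => //.
- by move=> k; exact: nonneg_vertex_poly.
- by move=> k x; exact: (curve_vertex_poly R i0 vertex_mnm0).
- by move=> x; rewrite !mxE; exact: pos_part_disjoint.
- by move=> k; rewrite [(- - c) _ _]mxE; exact: pos_part_disjoint.
Qed.

Definition parametrization : rational_map R d n :=
  @RationalMap R d n (laurent_numer f E (- c)) (laurent_numer f (- E) (- - c))
    (fun j => laurent_numer_neq0 (- E) (- - c) j f0) parametrization_coprime.

(** The identity [c *m A + B *m F = 1%:M] factors [u] into a part along [A], cancelled by the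
    normalization, and a part depending only on [monomial_map F u]. *)
Lemma parametrization_inverse u : torus u -> torus (cox_val F G A coef u) ->
  defined_at parametrization (monomial_map F u) /\
  rat_eval parametrization (monomial_map F u) = to_slice F G A c coef u.
Proof.
move=> tu Du; set t := monomial_map F u; have tt : torus t by exact: monomial_torus.
have valE : cox_val F G A coef u =
    fun k => monomial_map A u k * (monomial_map vmin t k * (f k).@[t]).
  by apply: funext => k; rewrite cox_val_vertex_poly.
have ft k : (f k).@[t] != 0.
  by have := Du k; rewrite valE !mulf_eq0 !negb_or => /and3P[].
split=> [j|]; first by have [] := laurent_eval E (- c) j tt ft.
apply: funext => j; have [_] := laurent_eval E (- c) j tt ft.
rewrite /rat_eval /= => ->; rewrite /to_slice valE !monomial_mul.
have -> : u j = monomial_map (c *m A) u j * monomial_map B t j.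
  case: AcB => h _ _; rewrite -[LHS](congr1 (@^~ j) (monomial1 u)) -h monomialD //.
  by rewrite (monomial_mulmx _ F).
have -> : monomial_map E t j = monomial_map B t j * monomial_map (- c) (monomial_map vmin t) j.
  by rewrite /E -mulNmx monomialD // (monomial_mulmx _ vmin).
have AA : monomial_map (c *m A) u j * monomial_map (- c) (monomial_map A u) j = 1.
  by rewrite -monomial_mulmx // mulNmx monomialN mulfV // monomial_torus.
by rewrite mulrACA !mulrA AA mul1r.
Qed.

Lemma parametrization_positive : positive_map parametrization.
Proof.
have pos E' c' j : nonneg_mpoly (laurent_numer f E' c' j).
  have exp_nonneg (p : {mpoly C[d]}) k : nonneg_mpoly p -> nonneg_mpoly (p ^+ k).
    move=> p0; elim: k => [|k IH]; first exact: nonneg_mpoly1.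
    by rewrite exprS; exact: nonneg_mpolyM.
  apply: nonneg_mpolyM; (elim/big_ind: _ => [|p q|k _];
    [exact: nonneg_mpoly1 | exact: nonneg_mpolyM | apply: exp_nonneg]).
    exact: nonneg_mpolyX.
  exact: nonneg_vertex_poly.
by move=> j m; split; exact: pos.
Qed.

(** The polytope of row [k] of [A] translated by [- vmin], to match the exponents of [f k]. *)
Let fvec k : 'cV[int]_n := (row k A)^T + F^T *m (row k vmin)^T.

Lemma newton_fits_vertex_poly k : newton_fits F G (f k) (fvec k).
Proof.
have vE i : vertex G i (fvec k) = exponent (vertex_mnm k i).
  by rewrite exponent_vertex_mnm vertexD /vertex mulmxA (fan_inv H) mul1mx.
split=> [|m|i]; first exact: nonneg_vertex_poly.
  move=> /msupp_sum_le /flattenP [s /mapP[i _ ->]] /msuppZ_le.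
  rewrite msuppX inE => /eqP-> j.
  by rewrite -vE -slackE slackD (slackF H) addr0 (slack_ge0 H).
by exists (vertex_mnm k i); [rewrite vE | exact: vertex_poly_gt0].
Qed.

Let lvec (E' : 'M[int]_(n, d)) (c' : 'M[int]_(n, r)) j : 'cV[int]_n :=
  (\sum_i (- (F^T *m exponent U_(i))) *+ pos_part (E' j i)) + \sum_k fvec k *+ pos_part (c' j k).

Lemma newton_fits_laurent E' c' j : newton_fits F G (laurent_numer f E' c' j) (lvec E' c' j).
Proof.
apply: newton_fitsM; apply: newton_fits_prod => k; apply: newton_fits_exp.
  exact: (newton_fitsX H).
exact: newton_fits_vertex_poly.
Qed.

Lemma slack_lvec i E' c' j : slack F G i (lvec E' c' j) =
  \sum_k slack F G i (row k A)^T *+ pos_part (c' j k).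
Proof.
have slackMn b k : slack F G i (b *+ k) = slack F G i b *+ k.
  by rewrite -!scaler_nat !natz; exact: slackZ.
rewrite slackD !slack_sum big1 ?add0r => [|x _]; last first.
  by rewrite slackMn -mulmxN (slackF H) mul0rn.
by apply: eq_bigr => k _; rewrite slackMn slackD (slackF H) addr0.
Qed.

Let nvec : 'cV[int]_n :=
  \sum_j (lvec E (- c) j + lvec (- E) (- - c) j).

Lemma parametrization_spans : spans_polytope F G (@newton_map R d n parametrization) nvec.
Proof.
apply: spans_big => j; apply: spans_minkowski;
  by apply: newton_spans => //; exact: newton_fits_laurent.
Qed.

(** Positive and negative parts of [c j k] add up to its absolute value. Since [A *m c = 1%:M], no
    column of [c] is zero, so every ample row occurs with positive weight. *)
Lemma parametrization_ample : ample F I G nvec.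
Proof.
move=> i l Il.
have slackE' : slack F G i nvec l 0 = \sum_j \sum_k
    slack F G i (row k A)^T l 0 *+ (pos_part (c j k) + pos_part (- c j k)).
  rewrite slack_sum summxE; apply: eq_bigr => j _.
  rewrite slackD !slack_lvec mxE !summxE -big_split; apply: eq_bigr => k _.
  by rewrite /= !mulmxnE !mxE opprK -mulrnDr addnC.
have term0 j k : 0 <= slack F G i (row k A)^T l 0 *+ (pos_part (c j k) + pos_part (- c j k)).
  by rewrite mulrn_wge0 // ltW // ampleA.
rewrite slackE' lt_neqAle sumr_ge0 ?andbT => [|j _]; last exact: sumr_ge0.
rewrite eq_sym psumr_neq0 => [|j _]; last exact: sumr_ge0.
have [k _] := completion_index H AcB Il.
have [j cjk] : exists j, c j k != 0.
  apply: contrapT => none; case: AcB => _ /matrixP/(_ k k) h _; move: h.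
  rewrite !mxE eqxx big1 // => j _; have [->|?] := eqVneq (c j k) 0; first by rewrite mulr0.
  by case: none; exists j.
apply/hasP; exists j; rewrite ?mem_index_enum // (bigD1 k) //= ltr_pwDl ?sumr_ge0 //.
by rewrite mulrn_wgt0 ?ampleA // pos_part_gt0.
Qed.

End SliceParametrization.

Theorem theorem1p1 (R : realType) (d n : nat) (P : set 'cV[R]_d)
    (F : 'M[int]_(d, n)) :
  lattice_polytope P -> full_dimensional P -> smooth_fan (normal_fan P) ->
  ray_matrix (normal_fan P) F ->
  let Sigma := normal_fan P in
  let X := toric_variety Sigma F in
  exists (U : set ('I_n -> R[i])) (UU : set (set ('I_n -> R[i]))),
    [/\ affine_variety U, U `<=` ~` cox_Z Sigma F,
        is_open X UU & is_affine (subspace X UU)] /\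
    [/\ isomorphism (subspace (affine_space R n) U)
                    (subspace X UU) (cox_pi F),
        exists phi : rational_map R d n,
          [/\ forall t, torus t -> UU (torus_point F t) ->
                [/\ defined_at phi t, U (rat_eval phi t)
                  & cox_pi F (rat_eval phi t) = torus_point F t],
              positive_map phi
            & normal_fan (newton_map phi) = Sigma]
      & cox_pi F @` (U `&` @nonneg_orthant R n) = toric_nonneg Sigma F].
Proof.
move=> [V ->] fullP smooth rayF Sigma X.
have [N [I [G [a [H PH Pv]]]]] := polytope_fan fullP rayF smooth.
have SE : Sigma = _ := normal_fanE H (fan_ample H) PH Pv.
have [r [A [c [B [AcB ampleA]]]]] := ample_completion H.
have [vmin vminP] := vertex_min H A.
have [i0 _] := fan_cover H 0.
have [cf [cf0 cf_coprime]] := coprime_coefficients R i0 (vertex_mnm0 vminP).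
pose coef := vertex_coef R i0 cf.
have coef0 k i : 0 < coef k i by exact: vertex_coef_gt0.
exists (slice F G A coef), (chart F G A coef); split; split.
- exact: (slice_affine_variety H SE AcB ampleA coef0).
- by move=> u Uu; apply: (torus_cox_val H SE AcB ampleA coef0); exact: slice_torus.
- exact: (open_chart H SE AcB ampleA coef0).
- exact: (chart_affine H SE AcB ampleA coef0).
- exact: (slice_isomorphism H SE AcB ampleA coef0).
- exists (parametrization c B vminP cf0 cf_coprime); split.
  (* The fibre over [t] is the orbit of some [u] with nonzero [cox_val], so it contains [u]. *)
  + move=> t tt [u Du E]; have [tu ut] : torus_point F t u by rewrite -E; exact: cox_pi_refl.
    rewrite -ut in E *.
    have [def ->] := parametrization_inverse H AcB ampleA vminP cf0 cf_coprime tu Du.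
    split=> //; first exact: (to_sliceP H AcB).
    by rewrite (cox_pi_slice AcB).
  + exact: parametrization_positive.
  + exact: (spans_normal_fan H (parametrization_ample H AcB ampleA vmin) (fan_ample H)
      (parametrization_spans H c B ampleA vminP cf0 cf_coprime) (conj PH Pv)).
- exact: (slice_nonneg H SE AcB ampleA coef0).
Qed.
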